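(* There exists an absolute constant $C_0\ge 1$ such that the following holds. Let $D,r,A\ge 1$, $0<\kappa\le 1/2$, and let $m\ge 0$ be an integer. Let $\delta>0$ satisfy $$\delta\le\left(\frac{\kappa^A}{C_0\exp(AD)}\right)^{10^{m+2}}.$$ Let $I_1,\dots,I_m$ be disjoint finite non-empty sets, and let $V$ be a finite set. For each $1\le j\le m$ and $i\in I_j$, let $\mathbf e_i$ be a random finite subset of $V$. Assume the following: 1. (Edges not too large) Almost surely, for all $j=1,\dots,m$ and $i\in I_j$, $\#\mathbf e_i\le r$. 2. (Each sieve step is sparse) For all $j=1,\dots,m$, $i\in I_j$ and $v\in V$, $\mathbb P(v\in\mathbf e_i)\le \dfrac{\delta}{(\# I_j)^{1/2}}$. 3. (Very small codegrees) For every $j=1,\dots,m$ and all distinct $v_1,v_2\in V$, $\displaystyle\sum_{i\in I_j}\mathbb P(v_1,v_2\in\mathbf e_i)\le\delta$. 4. (Degree bound) Introduce, for $v\in V$ and $j=1,\dots,m$, the normalized degrees $$d_{I_j}(v):=\sum_{i\in I_j}\mathbb P(v\in\mathbf e_i),$$ and define recursively $P_0(v):=1$ and $$P_{j+1}(v):=P_j(v)\exp\bigl(-d_{I_{j+1}}(v)/P_j(v)\bigr)\qquad(0\le j\le m-1,\ v\in V).$$ Then $$d_{I_j}(v)\le D\,P_{j-1}(v)\quad(1\le j\le m,\ v\in V),\qquad P_j(v)\ge\kappa\quad(0\le j\le m,\ v\in V).$$ Then one can find random variables $\mathbf e'_i$ (random subsets of $V$), for $i\in\bigcup_{j=1}^m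 I_j$, with the following properties: (a) For each $i\in\bigcup_{j=1}^m I_j$, almost surely $\mathbf e'_i$ is either empty or is a set that $\mathbf e_i$ also attains with positive probability. (b) For any integer $0\le J\le m$ and any finite subset $e$ of $V$ with $\# e\le A-2rJ$, $$\left|\,\mathbb P\Bigl(e\subset V\setminus\bigcup_{j=1}^J\bigcup_{i\in I_j}\mathbf e'_i\Bigr)-P_J(e)\right|\le \delta^{1/10^{J+1}}\,P_J(e),\qquad\text{where } P_J(e):=\prod_{v\in e}P_J(v).$$
   Context: $\#S$ denotes the cardinality of a finite set $S$; $\mathbb P$ denotes probability. The random variables $\mathbf e'_i$ are all defined jointly on a common probability space. *)

(* Defs.v *)
From HB Require Import structures.
From mathcomp Require Import all_boot all_order all_algebra.
From mathcomp Require Import all_classical all_reals all_analysis.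

Set Implicit Arguments.
Unset Strict Implicit.
Unset Printing Implicit Defensive.

Import Order.TTheory GRing.Theory Num.Theory.
Local Open Scope classical_set_scope.
Local Open Scope ring_scope.

(* The finite type [{set V}] carries the discrete sigma-algebra, so that a
   random subset of [V] is a random variable [X : {RV P >-> {set V}}]. *)
HB.instance Definition _ (V : finType) :=
  isPointed.Build {set V} (finset.set0 : {set V}).

HB.instance Definition _ (V : finType) :=
  @isMeasurable.Build default_measure_display {set V} discrete_measurable
    discrete_measurable0 discrete_measurableC discrete_measurableU.

(* Real-valued probability; [fine] loses nothing on measurable events, where a
   probability is finite. *)
Definition Pr (R : realType) (d : measure_display) (Omega : measurableType d)
  (P : probability Omega R) (E : set Omega) : R := fine (P E).

(* [d_J(v) = \sum_(i in J) P(v \in e_i)]; each [e i] may live on its own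
   probability space, only its law matters. *)
Definition norm_degree (R : realType) (T V : finType)
  (d : T -> measure_display) (Omega : forall i : T, measurableType (d i))
  (P : forall i : T, probability (Omega i) R)
  (e : forall i : T, {RV (P i) >-> {set V}}) (J : {set T}) (v : V) : R :=
  \sum_(i in J) Pr (P i) [set w | v \in e i w].

(* The recursion for [P_j(v)] is driven by the degrees [deg 1 v, deg 2 v, ...];
   the value [deg 0 v] is never used. *)
Fixpoint survival (R : realType) (V : finType) (deg : nat -> V -> R)
  (j : nat) (v : V) : R :=
  if j is k.+1 then
    survival deg k v * expR (- (deg k.+1 v / survival deg k v))
  else 1.

(* Main.v *)
Require Import Defs.
From HB Require Import structures.
From mathcomp Require Import all_boot all_order all_algebra.
From mathcomp Require Import all_classical all_reals all_analysis.
From mathcomp Require Import ring lra.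

Set Implicit Arguments.
Unset Strict Implicit.
Unset Printing Implicit Defensive.

Import Order.TTheory GRing.Theory Num.Theory.
Local Open Scope classical_set_scope.
Local Open Scope ring_scope.

(** Fix a stage, let [W] be the random set of vertices left uncovered by the
earlier stages, and suppose that [P(S \subset W)] is close to
[p(S) = \prod_(v in S) p v] for every [S] that is not too large, where [p] is
the survival function reached so far.  Conditionally on [W], the set [e' i]
takes the value [e] with probability proportional to
[P(e i = e) 1(e \subset W) / p(e)].  Dividing by [p(e)] compensates for the
chance that [e] lies in [W], so the normalizing constant [X_i] has mean about
[1].  When [X_i] is far from [1], [e' i] is empty.  Given [W], the sets [e' i]
of one stage are independent.

Given [W], a set [S] inside [W] therefore escapes the stage with probability
[\prod_i (1 - x_i)], where [x_i] is the conditional probability that [e' i]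
meets [S].  Sparsity makes every [x_i] small, so the product is close to
[exp (- \sum_i x_i)] ([prod_sub_exp_le]).  It remains to see that [\sum_i x_i]
is close to [\sum_(v in S) d(v) / p v] on the event [S \subset W], which is the
exponent in the recursion for the survival function.

Both concentration statements, for [X_i] and for [\sum_i x_i], concern random
variables of one shape, [\sum_e tau e 1(e \subset W) / p(e)], and both come
from a second moment computation ([deviation_le]).  A pair of edges [e], [f]
contributes [P(S :|: e :|: f \subset W) / (p(e) p(f))], which by the hypothesis
on [W] is nearly a product unless [e] and [f] share a vertex outside [S];
sparsity (for [X_i]) and small codegrees (for [\sum_i x_i]) make this rare.
The union [S :|: e :|: f] is why the admissible size of [S] drops by [2 r] at
each stage.

With [G = exp(A D) / kappa ^ A], the target probability [p(S) exp(...)] is at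
least [1 / G], and all errors sum up to at most [16 G ^ 8 eps ^ 2] when the
previous stage had relative error [eps ^ 10].  Since [eps] is at most
[(2 G) ^ (- 10)], this is a relative error [eps] ([step_estimate]); hence the
exponents [1 / 10 ^ (J + 1)] in the induction ([iterated_sieve]).

Only the laws of the [e i] matter, so the construction is carried out on
finite spaces with explicit weights, each stage multiplying the space by the
choices [{ffun T -> {set V}}]; the joint law of the [e' i] is turned into a
probability at the very end ([joint_probability]). *)

(** * Multiplicative weights of vertex sets *)

Section Weights.
Variables (R : realFieldType) (V : finType).
Implicit Types (p : V -> R) (S K e f : {set V}).

Definition weight p S : R := \prod_(v in S) p v.

Lemma weight0 p : weight p finset.set0 = 1.
Proof. by rewrite /weight big_set0. Qed.

Lemma weight_gt0 p S : (forall v, 0 < p v) -> 0 < weight p S.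
Proof. by move=> p0; apply: prodr_gt0. Qed.

Lemma weight_le1 p S : (forall v, 0 < p v <= 1) -> weight p S <= 1.
Proof.
move=> p01; apply: prodr_ile1 => v _.
by have /andP[/ltW -> ->] := p01 v.
Qed.

Lemma weightE p S : weight p S = \prod_v (if v \in S then p v else 1).
Proof. by rewrite /weight big_mkcond. Qed.

(** Each vertex is counted equally often on both sides; this is what measures
the failure of multiplicativity on overlapping sets. *)
Lemma weight_setU3 p S e f :
  weight p (S :|: (e :|: f)) *
    (weight p (e :&: S) * weight p (f :&: S) * weight p ((e :&: f) :\: S)) =
  weight p S * (weight p e * weight p f).
Proof.
rewrite !weightE -!big_split /=; apply: eq_bigr => v _.
rewrite !inE; case: (v \in S); case: (v \in e); case: (v \in f) => /=; ring.
Qed.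

Lemma weight_setU2 p S e : weight p (S :|: e) * weight p (e :&: S) = weight p S * weight p e.
Proof.
rewrite !weightE -!big_split /=; apply: eq_bigr => v _.
by rewrite !inE; case: (v \in S); case: (v \in e) => /=; ring.
Qed.

(** The value is [1] on the empty set, so a bound growing with [#|K|] lets the
cost of an overlap [K] be paid vertex by vertex. *)
Lemma weight_inv_le p G K : 1 <= G -> 0 < weight p K -> 1 <= G * weight p K ->
  (weight p K)^-1 <= 1 + G * #|K|%:R.
Proof.
move=> G1 K0 GK; have [->|/set0Pn[v vK]] := eqVneq K finset.set0.
  by rewrite weight0 invr1 cards0 mulr0 addr0.
have : (1 <= #|K|%:R :> R) by rewrite ler1n card_gt0; apply/set0Pn; exists v.
have : (weight p K)^-1 <= G by rewrite -[leLHS]mul1r ler_pdivrMr.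
nra.
Qed.

End Weights.

(** * Second moment of the mass of surviving edges *)

Section Moments.
Variables (R : realFieldType) (V Om : finType).
Variables (q : Om -> R) (W : Om -> {set V}) (p : V -> R).
Hypotheses (q_ge0 : forall w, 0 <= q w) (q_sum1 : \sum_w q w = 1).
Hypothesis (p01 : forall v, 0 < p v <= 1).
Implicit Types (S K e f : {set V}) (tau : {set V} -> R) (g h : Om -> R).

Definition expect g : R := \sum_w q w * g w.
Definition survives S w : R := (S \subset W w)%:R.
(** Each edge is reweighted by the inverse of its expected survival probability,
so that [kept_mass tau] has mean close to [\sum_e tau e]. *)
Definition kept_mass tau w : R := \sum_e tau e / weight p e * survives e w.
(** The conditional mean of [kept_mass tau] given that [S] survives: only the
part of [e] outside [S] still has to survive. *)
Definition mean_mass tau S : R := \sum_e tau e / weight p (e :&: S).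

Lemma expect_le g h : (forall w, g w <= h w) -> expect g <= expect h.
Proof. by move=> gh; apply: ler_sum => w _; apply: ler_wpM2l. Qed.

Lemma expect_lin a g h : expect (fun w => g w + a * h w) = expect g + a * expect h.
Proof.
by rewrite /expect mulr_sumr -big_split /=; apply: eq_bigr => w _; ring.
Qed.

Lemma expect_add g h : expect (fun w => g w + h w) = expect g + expect h.
Proof. by rewrite /expect -big_split /=; apply: eq_bigr => w _; rewrite mulrDr. Qed.

Lemma expect_sum (I : finType) (P : pred I) (F : I -> Om -> R) :
  expect (fun w => \sum_(i | P i) F i w) = \sum_(i | P i) expect (F i).
Proof.
by rewrite /expect exchange_big /=; apply: eq_bigr => w _; rewrite mulr_sumr.
Qed.

Lemma expect_scale a g : expect (fun w => a * g w) = a * expect g.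
Proof. by rewrite /expect mulr_sumr; apply: eq_bigr => w _; rewrite mulrCA. Qed.

Lemma expect_cst a : expect (fun=> a) = a.
Proof. by rewrite /expect -mulr_suml q_sum1 mul1r. Qed.

Lemma survivesU S e w : survives (S :|: e) w = survives S w * survives e w.
Proof. by rewrite /survives finset.subUset -natrM mulnb. Qed.

Lemma survives_ge0 S w : 0 <= survives S w.
Proof. exact: ler0n. Qed.

Lemma survives_le1 S w : survives S w <= 1.
Proof. by rewrite /survives lern1 leq_b1. Qed.

Lemma expect_survives_kept_mass S tau :
  expect (fun w => survives S w * kept_mass tau w) =
  \sum_e tau e / weight p e * expect (survives (S :|: e)).
Proof.
rewrite -(eq_bigr _ (fun e _ => expect_scale _ _)) -expect_sum; apply: eq_bigr => w _.
congr (_ * _); rewrite mulr_sumr; apply: eq_bigr => e _.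
by rewrite survivesU; ring.
Qed.

Lemma expect_survives_kept_mass2 S tau :
  expect (fun w => survives S w * kept_mass tau w ^+ 2) =
  \sum_e \sum_f tau e / weight p e * (tau f / weight p f) *
    expect (survives (S :|: (e :|: f))).
Proof.
under eq_bigr => e _.
  rewrite -(eq_bigr _ (fun f _ => expect_scale _ _)) -expect_sum.
  over.
rewrite -expect_sum; apply: eq_bigr => w _.
congr (_ * _); rewrite expr2 big_distrlr /= mulr_sumr; apply: eq_bigr => e _.
rewrite mulr_sumr; apply: eq_bigr => f _.
by rewrite !survivesU; ring.
Qed.

(** The inequality of arithmetic and geometric means, with a free [c], replaces
Cauchy-Schwarz and avoids square roots of error terms. *)
Lemma expect_abs_le (c : R) g S : 0 < c ->
  expect (fun w => survives S w * `|g w|) <=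
  (c + expect (fun w => survives S w * g w ^+ 2) / c) / 2.
Proof.
move=> c0; pose h w := c / 2 + (2 * c)^-1 * (survives S w * g w ^+ 2).
apply: (@le_trans _ _ (expect h)).
  apply: expect_le => w; rewrite /h.
  have := survives_ge0 S w; have := survives_le1 S w.
  rewrite -(real_normK (num_real (g w))).
  set s := survives S w; set x := `|g w| => s1 s0.
  have : 0 <= (2 * c)^-1 * (x - c) ^+ 2 * s.
    by apply: mulr_ge0 => //; apply: mulr_ge0; rewrite ?sqr_ge0// invr_ge0; lra.
  have -> : (2 * c)^-1 * (x - c) ^+ 2 * s =
            (2 * c)^-1 * (s * x ^+ 2) - s * x + c / 2 * s.
    by field; lra.
  have : c / 2 * s <= c / 2 * 1 by apply: ler_wpM2l => //; lra.
  lra.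
rewrite /h expect_lin expect_cst le_eqVlt; apply/orP; left; apply/eqP.
by field; lra.
Qed.

Variables (a B r G : R).
Hypotheses (a0 : 0 <= a) (G1 : 1 <= G) (r0 : 0 <= r).
Hypothesis approx : forall S, #|S|%:R <= B + 2 * r ->
  `|expect (survives S) - weight p S| <= a * weight p S.
Hypothesis Gwt : forall K, #|K|%:R <= r -> 1 <= G * weight p K.

Variables (tau : {set V} -> R) (S : {set V}).
Hypothesis tau0 : forall e, 0 <= tau e.
Hypothesis tau_supp : forall e, tau e != 0 -> #|e|%:R <= r.
Hypothesis SB : #|S|%:R <= B.

Let p_gt0 v : 0 < p v. Proof. by have /andP[] := p01 v. Qed.
Let weight_p_gt0 K : 0 < weight p K. Proof. exact: weight_gt0. Qed.

Lemma weight_inv_leG K e : K \subset e -> #|e|%:R <= r -> (weight p K)^-1 <= G.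
Proof.
move=> Ke er; rewrite -[leLHS]mul1r ler_pdivrMr//; apply: Gwt.
by apply: le_trans er; rewrite ler_nat subset_leq_card.
Qed.

Lemma mean_mass_ge0 : 0 <= mean_mass tau S.
Proof. by apply: sumr_ge0 => e _; rewrite divr_ge0// ltW. Qed.

Lemma mean_mass_le : mean_mass tau S <= G * \sum_e tau e.
Proof.
rewrite mulr_sumr; apply: ler_sum => e _.
have [->|te] := eqVneq (tau e) 0; first by rewrite mul0r mulr0.
by rewrite mulrC ler_wpM2r// (weight_inv_leG (subsetIl _ _) (tau_supp te)).
Qed.

(** A lower bound, because the first moment enters the expansion of the square
with a negative sign. *)
Lemma first_moment_ge :
  (1 - a) * (weight p S * mean_mass tau S) <=
  expect (fun w => survives S w * kept_mass tau w).
Proof.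
rewrite expect_survives_kept_mass !mulr_sumr; apply: ler_sum => e _.
have [->|te] := eqVneq (tau e) 0; first by rewrite !mul0r !mulr0.
have er := tau_supp te.
have ap : `|expect (survives (S :|: e)) - weight p (S :|: e)| <= a * weight p (S :|: e).
  apply: approx; have : (#|S :|: e|%:R <= #|S|%:R + #|e|%:R :> R).
    by rewrite -natrD ler_nat cardsU leq_subr.
  by move: r0 SB er; lra.
have -> : (1 - a) * (weight p S * (tau e / weight p (e :&: S))) =
          tau e / weight p e * ((1 - a) * weight p (S :|: e)).
  have := weight_setU2 p S e; have := weight_p_gt0 e; have := weight_p_gt0 (e :&: S).
  move=> h1 h2 h3; have -> : weight p (S :|: e) = weight p S * weight p e / weight p (e :&: S).
    by rewrite -h3 mulfK// gt_eqF.
  by field; rewrite !gt_eqF.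
apply: ler_wpM2l; first by rewrite divr_ge0// ltW.
by move: ap; rewrite ler_norml => /andP[]; lra.
Qed.

Variable theta : R.
Hypothesis theta_max : forall v, v \notin S ->
  \sum_(e : {set V} | v \in e) tau e <= theta.
Hypothesis theta0 : 0 <= theta.

(** Counting overlaps by their common vertex [v] gives the square of the degree
of [v]; one factor is at most [theta], the other sums to [\sum_e tau e * #|e|]. *)
Lemma pair_overlap_le :
  \sum_(e : {set V}) \sum_(f : {set V}) tau e * tau f * #|(e :&: f) :\: S|%:R <=
  theta * (r * \sum_e tau e).
Proof.
have -> : \sum_(e : {set V}) \sum_(f : {set V}) tau e * tau f * #|(e :&: f) :\: S|%:R =
    \sum_(v | v \notin S) (\sum_(e : {set V} | v \in e) tau e) ^+ 2.
  under [RHS]eq_bigr => v _.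
    rewrite expr2 big_mkcond big_distrlr /=.
    over.
  rewrite [RHS]exchange_big /=; apply: eq_bigr => e _.
  rewrite [RHS]exchange_big /=; apply: eq_bigr => f _.
  rewrite -sum1_card natr_sum mulr_sumr big_mkcond [RHS]big_mkcond /=.
  apply: eq_bigr => v _; rewrite !inE.
  by case: (v \in S); case: (v \in e); case: (v \in f) => /=;
    rewrite ?mulr1 ?mul0r ?mulr0.
apply: (@le_trans _ _ (\sum_v theta * \sum_(e : {set V} | v \in e) tau e)).
  rewrite [leRHS](bigID (fun v => v \notin S)) /= -[leLHS]addr0 lerD//.
    apply: ler_sum => v vS; rewrite expr2 ler_wpM2r ?theta_max//.
    exact: sumr_ge0.
  by apply: sumr_ge0 => v _; rewrite mulr_ge0// sumr_ge0.
rewrite -mulr_sumr ler_wpM2l//.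
under eq_bigr => v _ do rewrite big_mkcond /=.
rewrite exchange_big /= mulr_sumr; apply: ler_sum => e _.
rewrite -big_mkcond /= sumr_const.
have [->|te] := eqVneq (tau e) 0; first by rewrite mul0rn mulr0.
by rewrite -mulr_natl ler_wpM2r// tau_supp.
Qed.

(** The main term factorizes as [mean_mass ^ 2]; the correction comes only from
pairs of edges sharing a vertex outside [S]. *)
Lemma second_moment_le :
  expect (fun w => survives S w * kept_mass tau w ^+ 2) <=
  (1 + a) * (weight p S *
    (mean_mass tau S ^+ 2 + G ^+ 3 * (theta * (r * \sum_e tau e)))).
Proof.
rewrite expect_survives_kept_mass2.
apply: (@le_trans _ _ ((1 + a) * (weight p S *
    (mean_mass tau S ^+ 2 +
     G ^+ 3 * \sum_(e : {set V}) \sum_(f : {set V}) tau e * tau f * #|(e :&: f) :\: S|%:R)))); last first.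
  rewrite ler_wpM2l ?addr_ge0//; apply: ler_wpM2l; first exact: ltW.
  rewrite lerD2l ler_wpM2l ?pair_overlap_le//.
  by rewrite exprn_ge0//; apply: le_trans G1.
rewrite expr2 big_distrlr /= mulr_sumr -big_split /= !mulr_sumr.
apply: ler_sum => e _; rewrite mulr_sumr -big_split /= !mulr_sumr.
apply: ler_sum => f _.
have [->|te] := eqVneq (tau e) 0; first by rewrite !(mul0r, mulr0) addr0 !mulr0.
have [->|tf] := eqVneq (tau f) 0; first by rewrite !(mul0r, mulr0) addr0 !mulr0.
have er := tau_supp te; have fr := tau_supp tf.
have ap : `|expect (survives (S :|: (e :|: f))) - weight p (S :|: (e :|: f))| <=
    a * weight p (S :|: (e :|: f)).
  apply: approx; have : (#|S :|: (e :|: f)|%:R <= #|S|%:R + (#|e|%:R + #|f|%:R) :> R).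
    rewrite -!natrD ler_nat cardsU (leq_trans (leq_subr _ _))// leq_add2l.
    by rewrite cardsU leq_subr.
  by move: r0 SB er fr; lra.
have {ap} ap : expect (survives (S :|: (e :|: f))) <= (1 + a) * weight p (S :|: (e :|: f)).
  by move: ap; rewrite ler_norml => /andP[]; lra.
apply: (@le_trans _ _ (tau e / weight p e * (tau f / weight p f) *
   ((1 + a) * weight p (S :|: (e :|: f))))).
  by rewrite ler_wpM2l// mulr_ge0// divr_ge0// ltW.
have h := weight_setU3 p S e f.
have -> : weight p (S :|: (e :|: f)) = weight p S * (weight p e * weight p f) /
    (weight p (e :&: S) * weight p (f :&: S) * weight p (e :&: f :\: S)).
  by rewrite -h mulfK// !mulf_neq0 ?gt_eqF.
set u := weight p (e :&: S); set u' := weight p (f :&: S).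
set k := weight p (e :&: f :\: S); set n := #|_|%:R.
have u0 : 0 < u by exact: weight_p_gt0.
have u'0 : 0 < u' by exact: weight_p_gt0.
have k0 : 0 < k by exact: weight_p_gt0.
have uG : u^-1 <= G := weight_inv_leG (subsetIl _ _) er.
have u'G : u'^-1 <= G := weight_inv_leG (subsetIl _ _) fr.
have kG : k^-1 <= 1 + G * n.
  apply: weight_inv_le => //; apply: Gwt; apply: le_trans er.
  rewrite ler_nat subset_leq_card//; apply: fintype.subset_trans (finset.subsetDl _ _) _.
  exact: subsetIl.
have -> : tau e / weight p e * (tau f / weight p f) * ((1 + a) *
    (weight p S * (weight p e * weight p f) / (u * u' * k))) =
   (1 + a) * (weight p S * (tau e * tau f * (u^-1 * u'^-1 * k^-1))).
  by field; rewrite !gt_eqF.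
rewrite ler_wpM2l ?addr_ge0//; apply: ler_wpM2l; first exact: ltW.
have -> : tau e / u * (tau f / u') + G ^+ 3 * (tau e * tau f * n) =
  tau e * tau f * (u^-1 * u'^-1 + G ^+ 3 * n) by ring.
rewrite ler_wpM2l ?mulr_ge0//.
have n0 : 0 <= n by exact: ler0n.
have iu0 : 0 <= u^-1 by rewrite invr_ge0 ltW.
have iu'0 : 0 <= u'^-1 by rewrite invr_ge0 ltW.
apply: (@le_trans _ _ (u^-1 * u'^-1 * (1 + G * n))).
  by rewrite ler_wpM2l// mulr_ge0.
rewrite mulrDr mulr1 lerD2l mulrA exprSr ler_wpM2r// ler_wpM2r//; first exact: le_trans G1.
by rewrite expr2 ler_pM.
Qed.

(** Expand the square; [y] is left free because the natural centre is not the
exact mean but the load prescribed by the degrees. *)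
Lemma deviation_le (y : R) : 0 <= y ->
  expect (fun w => survives S w * (kept_mass tau w - y) ^+ 2) <=
  weight p S * ((mean_mass tau S - y) ^+ 2 + a * (mean_mass tau S + y) ^+ 2 +
    (1 + a) * (G ^+ 3 * (theta * (r * \sum_e tau e)))).
Proof.
move=> y0.
have -> : expect (fun w => survives S w * (kept_mass tau w - y) ^+ 2) =
  expect (fun w => survives S w * kept_mass tau w ^+ 2)
  + (- (2 * y)) * expect (fun w => survives S w * kept_mass tau w)
  + y ^+ 2 * expect (survives S).
  by rewrite -!expect_lin; apply: eq_bigr => w _; ring.
have := second_moment_le; have := first_moment_ge.
have : expect (survives S) <= (1 + a) * weight p S.
  have : `|expect (survives S) - weight p S| <= a * weight p S by apply: approx; move: r0 SB; lra.
  by rewrite ler_norml => /andP[]; lra.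
set E0 := expect _; set E1 := expect _; set E2 := expect _; set M := mean_mass _ _.
set Q := G ^+ 3 * _; set s := weight p S => h0 h1 h2.
have : y ^+ 2 * E0 <= y ^+ 2 * ((1 + a) * s) by rewrite ler_wpM2l// sqr_ge0.
have : 2 * y * ((1 - a) * (s * M)) <= 2 * y * E1 by rewrite ler_wpM2l//; lra.
lra.
Qed.

End Moments.

Arguments survives {R V Om} W S w.

(** * Edges that meet a given set *)

Section Meeting.
Variables (R : realFieldType) (V : finType).
Implicit Types (p : V -> R) (S K e : {set V}) (rho tau : {set V} -> R).

Definition meeting S rho e : R := if e :&: S != finset.set0 then rho e else 0.

Definition degree rho v : R := \sum_(e : {set V} | v \in e) rho e.

Definition codegree rho s t : R :=
  \sum_(e : {set V} | (s \in e) && (t \in e)) rho e.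

Lemma sum_degree S rho :
  \sum_(v in S) degree rho v = \sum_e rho e * #|e :&: S|%:R.
Proof.
rewrite (exchange_big_dep xpredT) //=; apply: eq_bigr => e _.
rewrite sumr_const mulr_natr; congr (_ *+ _); apply: eq_card => v.
by rewrite !inE andbC.
Qed.

Lemma meeting_ge0 S rho : (forall e, 0 <= rho e) -> forall e, 0 <= meeting S rho e.
Proof. by move=> h e; rewrite /meeting; case: ifP. Qed.

Lemma meeting_supp S rho e : meeting S rho e != 0 -> rho e != 0.
Proof. by rewrite /meeting; case: ifP => // _; rewrite eqxx. Qed.

Lemma meeting_le S rho e : 0 <= rho e ->
  meeting S rho e <= rho e * #|e :&: S|%:R.
Proof.
rewrite /meeting => h; case: ifP => [K0|/negbFE/eqP ->]; last first.
  by rewrite cards0 mulr0.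
by rewrite -[leLHS]mulr1 ler_wpM2l// ler1n card_gt0.
Qed.

Lemma sum_meeting_le S rho : (forall e, 0 <= rho e) ->
  \sum_e meeting S rho e <= \sum_(v in S) degree rho v.
Proof.
by move=> h; rewrite sum_degree; apply: ler_sum => e _; apply: meeting_le.
Qed.

(** For [v] outside [S], an edge through [v] that meets [S] contains a pair, so
the codegrees bound the parameter [theta] of the second moment computation. *)
Lemma degree_meeting_le S rho v : (forall e, 0 <= rho e) ->
  degree (meeting S rho) v <= \sum_(s in S) codegree rho s v.
Proof.
move=> h; rewrite (exchange_big_dep (fun e : {set V} => v \in e)) /=; last first.
  by move=> s e _ /andP[].
apply: ler_sum => e ve; apply: le_trans (meeting_le _ (h e)) _.
rewrite sumr_const mulr_natr le_eqVlt; apply/orP; left; apply/eqP.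
by congr (_ *+ _); apply: eq_card => s; rewrite !inE ve [RHS]unfold_in andbT andbC.
Qed.

(** The two quantities agree when [e] meets [S] in at most one vertex.
Otherwise both lie in [[0, G ^ 2]], and the sum on the right is at least [1]. *)
Lemma inv_weight_linear_le p (G r : R) S e :
  (forall v, 0 < p v <= 1) -> 1 <= r -> r <= G ->
  (forall K, #|K|%:R <= r -> 1 <= G * weight p K) -> #|e|%:R <= r ->
  `|(if e :&: S != finset.set0 then (weight p (e :&: S))^-1 else 0)
    - \sum_(v in e :&: S) (p v)^-1| <=
  G ^+ 2 * \sum_(s in S) \sum_(t in S | t != s) ((s \in e) && (t \in e))%:R.
Proof.
move=> p01 r1 rG Gwt er; set K := e :&: S.
have p0 v : 0 < p v by have /andP[] := p01 v.
have pairs0 : 0 <= \sum_(s in S) \sum_(t in S | t != s)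
    ((s \in e) && (t \in e))%:R :> R.
  by apply: sumr_ge0 => s _; apply: sumr_ge0.
have [K0|/set0Pn[s sK]] /= := eqVneq K finset.set0.
  by rewrite K0 big_set0 subrr normr0 mulr_ge0// sqr_ge0.
have [K1|] := eqVneq (K :\ s) finset.set0.
  have -> : K = [set s]%SET by rewrite -(finset.setD1K sK) K1 finset.setU0.
  by rewrite /weight !big_set1 subrr normr0 mulr_ge0// sqr_ge0.
case/set0Pn=> t; rewrite in_setD1 => /andP[ts tK].
have KG : (weight p K)^-1 <= G := weight_inv_leG p01 Gwt (subsetIl _ _) er.
have K0 : 0 <= (weight p K)^-1 by rewrite invr_ge0 ltW// weight_gt0.
have L0 : 0 <= \sum_(v in K) (p v)^-1.
  by apply: sumr_ge0 => v _; rewrite invr_ge0 ltW.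
have LG : \sum_(v in K) (p v)^-1 <= G ^+ 2.
  apply: (@le_trans _ _ (\sum_(v in K) G)).
    apply: ler_sum => v _.
    have -> : p v = weight p [set v]%SET by rewrite /weight big_set1.
    by apply: (weight_inv_leG p01 Gwt (fintype.subxx _)); rewrite cards1.
  rewrite sumr_const -mulr_natl expr2 ler_wpM2r//; first by lra.
  apply: le_trans rG; apply: le_trans er.
  by rewrite ler_nat subset_leq_card// subsetIl.
have P1 : 1 <= \sum_(s in S) \sum_(t in S | t != s)
    ((s \in e) && (t \in e))%:R :> R.
  move: sK tK; rewrite !inE => /andP[se sS] /andP[te tS].
  rewrite (bigD1 s)//= (bigD1 t) /=; last by rewrite tS.
  rewrite se te -addrA lerDl addr_ge0//; first exact: sumr_ge0.
  by apply: sumr_ge0 => u _; apply: sumr_ge0.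
have GG : G <= G ^+ 2 by rewrite expr2 ler_peMl; lra.
apply: (@le_trans _ _ (G ^+ 2)); last by rewrite ler_peMr// sqr_ge0.
by rewrite ler_norml; apply/andP; split; lra.
Qed.

(** Edges meeting [S] at least twice are negligible because of the codegrees;
the other ones see [S] through a single vertex, which makes the mean additive
in the vertices of [S]. *)
Lemma mean_mass_meeting p (G r delta : R) S rho :
  (forall v, 0 < p v <= 1) -> 1 <= r -> r <= G -> 0 <= delta ->
  (forall K, #|K|%:R <= r -> 1 <= G * weight p K) ->
  (forall e, 0 <= rho e) -> (forall e, rho e != 0 -> #|e|%:R <= r) ->
  (forall s t, s != t -> codegree rho s t <= delta) ->
  `|mean_mass p (meeting S rho) S - \sum_(v in S) degree rho v / p v| <=
  G ^+ 2 * (#|S|%:R ^+ 2 * delta).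
Proof.
move=> p01 r1 rG delta0 Gwt rho0 supp codeg.
have G0 : 0 <= G by lra.
have -> : \sum_(v in S) degree rho v / p v =
    \sum_e rho e * \sum_(v in e :&: S) (p v)^-1.
  under eq_bigr => v _ do rewrite /degree mulr_suml.
  rewrite (exchange_big_dep xpredT) //=; apply: eq_bigr => e _.
  by rewrite mulr_sumr; apply: eq_bigl => v; rewrite !inE andbC.
rewrite /mean_mass -sumrB; apply: le_trans (ler_norm_sum _ _ _) _.
apply: (@le_trans _ _ (\sum_e rho e * (G ^+ 2 *
  \sum_(s in S) \sum_(t in S | t != s) ((s \in e) && (t \in e))%:R))).
  apply: ler_sum => e _; have [re|re] := eqVneq (rho e) 0.
    by rewrite /meeting re if_same !mul0r subrr normr0.
  have -> : meeting S rho e / weight p (e :&: S) = rho e *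
      (if e :&: S != finset.set0 then (weight p (e :&: S))^-1 else 0).
    by rewrite /meeting; case: ifP => _; rewrite ?mul0r ?mulr0.
  rewrite -mulrBr normrM ger0_norm// ler_wpM2l//.
  exact: inv_weight_linear_le (supp _ re).
under eq_bigr => e _ do rewrite mulrCA mulr_sumr.
rewrite -mulr_sumr ler_wpM2l ?exprn_ge0// exchange_big /=.
have -> : #|S|%:R ^+ 2 * delta = \sum_(s in S) \sum_(t in S) delta.
  by rewrite !sumr_const -mulrnA -[delta *+ _]mulr_natl natrM expr2.
apply: ler_sum => s sS.
under eq_bigr => e _ do rewrite mulr_sumr.
rewrite exchange_big /= big_mkcondr /=; apply: ler_sum => t tS.
have le_codeg : s != t -> \sum_e rho e * ((s \in e) && (t \in e))%:R <= delta.
  move=> /codeg; apply: le_trans; rewrite /codegree [leRHS]big_mkcond /=.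
  by apply: ler_sum => e _; case: ifP; rewrite ?mulr1 ?mulr0.
case: ifP => [ts|_]; first by rewrite le_codeg// eq_sym.
by [].
Qed.

End Meeting.

(** * Products close to exponentials *)

Section ProductVsExponential.
Variable R : realType.

Lemma expRN_sub_le (x : R) : 0 <= x <= 1 -> `|(1 - x) - expR (- x)| <= x ^+ 2.
Proof.
move=> /andP[x0 x1].
have lo : 1 - x <= expR (- x) by exact: expR_ge1Dx.
have up : expR (- x) * (1 + x) <= 1.
  have e0 : 0 < expR (- x) := expR_gt0 _.
  have {2}<- : expR (- x) * expR x = 1 by rewrite -expRD addNr expR0.
  by rewrite ler_wpM2l ?expR_ge1Dx// ltW.
have h : expR (- x) <= 1 - x + x ^+ 2.
  rewrite -(@ler_pM2r _ (1 + x)); last lra.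
  apply: le_trans up _.
  have -> : (1 - x + x ^+ 2) * (1 + x) = 1 + x ^+ 3 by ring.
  by rewrite lerDl exprn_ge0.
by rewrite ler0_norm; lra.
Qed.

Lemma expRN_lip (x y : R) : 0 <= x -> 0 <= y ->
  `|expR (- x) - expR (- y)| <= `|x - y|.
Proof.
wlog xy : x y / x <= y => [hw x0 y0|x0 y0].
  have [xy|/ltW yx] := leP x y; first exact: hw.
  by rewrite distrC (distrC x); apply: hw.
have -> : expR (- y) = expR (- x) * expR (- (y - x)).
  by rewrite -expRD; congr expR; ring.
have e1 : expR (- x) <= 1 by rewrite -expR0 ler_expR; lra.
have e2 : expR (- (y - x)) <= 1 by rewrite -expR0 ler_expR; lra.
have e3 := expR_ge1Dx (- (y - x)).
have e0 : 0 < expR (- x) := expR_gt0 _.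
have : `|x - y| = y - x by rewrite distrC ger0_norm; lra.
move=> ->; rewrite ger0_norm; last by nra.
by nra.
Qed.

Lemma prod_sub_exp_le (I : finType) (A : {set I}) (x : I -> R) (y : R) :
  (forall i, i \in A -> 0 <= x i <= 1) -> 0 <= y ->
  `|\prod_(i in A) (1 - x i) - expR (- y)| <=
  \sum_(i in A) x i ^+ 2 + `|\sum_(i in A) x i - y|.
Proof.
move=> x01 y0.
have [P01 s0 h] : [/\ 0 <= \prod_(i in A) (1 - x i) <= 1,
    0 <= \sum_(i in A) x i &
    `|\prod_(i in A) (1 - x i) - expR (- \sum_(i in A) x i)| <=
      \sum_(i in A) x i ^+ 2].
  elim/big_rec3: _ => [|i C B P /x01 xi [/andP[P0 P1] B0 PC]].
    by rewrite oppr0 expR0 subrr normr0; split; rewrite ?ler01 ?lexx.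
  have /andP[xi0 xi1] := xi.
  split; [apply/andP; split; by nra|lra|].
  have -> : (1 - x i) * P - expR (- (x i + B)) =
    (1 - x i) * (P - expR (- B)) + ((1 - x i) - expR (- x i)) * expR (- B).
    by rewrite opprD expRD; ring.
  apply: le_trans (ler_normD _ _) _; rewrite !normrM addrC.
  have e1 : expR (- B) <= 1 by rewrite -expR0 ler_expR; lra.
  have e0 : 0 < expR (- B) := expR_gt0 _.
  apply: lerD.
    rewrite (ger0_norm (ltW e0)) -[leRHS]mulr1.
    by apply: ler_pM => //; exact: expRN_sub_le.
  rewrite -[leRHS]mul1r; apply: ler_pM => //.
  by rewrite ger0_norm; lra.
have -> : \prod_(i in A) (1 - x i) - expR (- y) =
    (\prod_(i in A) (1 - x i) - expR (- \sum_(i in A) x i)) +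
    (expR (- \sum_(i in A) x i) - expR (- y)) by ring.
apply: le_trans (ler_normD _ _) _; apply: lerD => //.
exact: expRN_lip.
Qed.

End ProductVsExponential.

(** * One stage of the sieve *)

Section Step.
Variables (R : realType) (V T Om : finType).
Variables (q : Om -> R) (W : Om -> {set V}) (p : V -> R).
Variables (I : {set T}) (pi : T -> {set V} -> R) (r B G D delta b : R).
Hypotheses (q_ge0 : forall w, 0 <= q w) (q_sum1 : \sum_w q w = 1).
Hypothesis (p01 : forall v, 0 < p v <= 1).
Hypotheses (b01 : 0 <= b <= 1) (delta_b : 0 <= delta <= b) (B0 : 0 <= B).
Hypotheses (r1G : 1 <= r <= G) (D0G : 0 <= D <= G).
Hypothesis approx : forall S : {set V}, #|S|%:R <= B + 2 * r ->
  `|expect q (survives W S) - weight p S| <= b * weight p S.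
Hypothesis Gwt : forall K : {set V}, #|K|%:R <= r -> 1 <= G * weight p K.
Hypotheses (pi_ge0 : forall i e, 0 <= pi i e).
Hypotheses (pi_sum1 : forall i, \sum_e pi i e = 1).
Hypothesis pi_supp : forall i e, i \in I -> pi i e != 0 -> #|e|%:R <= r.
Hypothesis sparse : forall i v, i \in I ->
  degree (pi i) v <= delta / Num.sqrt #|I|%:R.
Hypothesis codeg : forall s t, s != t ->
  \sum_(i in I) codegree (pi i) s t <= delta.
Hypothesis deg : forall v, \sum_(i in I) degree (pi i) v <= D * p v.
Implicit Types (S e : {set V}) (w : Om) (i : T).

(** The exponent by which the survival probability of [S] decreases during the
stage. *)
Definition rate S : R := \sum_(v in S) (\sum_(i in I) degree (pi i) v) / p v.

(** The threshold [1 / 2] makes the error of replacing the true mass by [1] at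
most [2 * `|X_i - 1|] in all cases: when typical, because [X_i >= 1 / 2]; when
atypical, because then [2 * `|X_i - 1| >= 1]. *)
Definition typical i w := `|kept_mass W p (pi i) w - 1| <= 1 / 2.

(** The conditional law of [e' i] given the history [w]. *)
Definition edge_law w i e : R :=
  if typical i w then pi i e / weight p e * survives W e w / kept_mass W p (pi i) w
  else (e == finset.set0)%:R.

Definition hit S i w : R := \sum_(e | e :&: S != finset.set0) edge_law w i e.

Definition intensity e : R := \sum_(i in I) pi i e.

Let p_gt0 v : 0 < p v. Proof. by have /andP[] := p01 v. Qed.
Let weight_p_gt0 (K : {set V}) : 0 < weight p K. Proof. exact: weight_gt0. Qed.

Lemma typical_ge i w : typical i w -> 1 / 2 <= kept_mass W p (pi i) w.
Proof. by rewrite /typical ler_norml => /andP[]; lra. Qed.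

Lemma edge_law_ge0 w i e : 0 <= edge_law w i e.
Proof.
rewrite /edge_law; case: ifP => // /typical_ge X0.
by rewrite !mulr_ge0// ?survives_ge0// invr_ge0; [exact: ltW|lra].
Qed.

Lemma edge_law_sum1 w i : \sum_e edge_law w i e = 1.
Proof.
rewrite /edge_law; have [gd|/negbTE bad] := boolP (typical i w).
  by have X0 := typical_ge gd; rewrite -mulr_suml divff// gt_eqF//; apply: lt_le_trans X0; lra.
by rewrite (bigD1 finset.set0)//= eqxx big1 ?addr0// => e /negbTE ->.
Qed.

Lemma edge_law_supp w i e : 0 < edge_law w i e -> e = finset.set0 \/ 0 < pi i e.
Proof.
rewrite /edge_law; case: ifP => [_ h|_]; last by case: eqP => [->|_]; [left|rewrite ltxx].
right; rewrite lt_neqAle pi_ge0 andbT eq_sym; apply: contraTneq h => ->.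
by rewrite !mul0r ltxx.
Qed.

Lemma hit01 S i w : 0 <= hit S i w <= 1.
Proof.
rewrite sumr_ge0 => [|e _]; last exact: edge_law_ge0.
rewrite -(edge_law_sum1 w i) [leRHS](bigID (fun e : {set V} => e :&: S != finset.set0)) /=.
by rewrite lerDl sumr_ge0// => e _; exact: edge_law_ge0.
Qed.

Lemma miss_hit S i w :
  \sum_(e | e :&: S == finset.set0) edge_law w i e = 1 - hit S i w.
Proof.
rewrite -(edge_law_sum1 w i) [in RHS](bigID (fun e : {set V} => e :&: S != finset.set0)) /=.
rewrite addrC addrK; apply: eq_bigl => e; by rewrite negbK.
Qed.

Lemma kept_mass_ge0 tau w : (forall e, 0 <= tau e) -> 0 <= kept_mass W p tau w.
Proof.
move=> t0; apply: sumr_ge0 => e _.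
by rewrite !mulr_ge0// ?survives_ge0// invr_ge0 ltW.
Qed.

Lemma hit_typical S i w : typical i w ->
  hit S i w = kept_mass W p (meeting S (pi i)) w / kept_mass W p (pi i) w.
Proof.
move=> gd; rewrite /hit /edge_law gd -mulr_suml; congr (_ / _).
rewrite big_mkcond /=; apply: eq_bigr => e _; rewrite /meeting.
by case: ifP => _; rewrite ?mul0r.
Qed.

Lemma hit_atypical S i w : ~~ typical i w -> hit S i w = 0.
Proof.
move=> /negbTE bad; rewrite /hit /edge_law bad big1// => e.
by case: (e =P finset.set0) => // ->; rewrite finset.set0I eqxx.
Qed.

Lemma hit_sub_le S i w :
  `|hit S i w - kept_mass W p (meeting S (pi i)) w| <=
  2 * kept_mass W p (meeting S (pi i)) w * `|kept_mass W p (pi i) w - 1|.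
Proof.
set u := kept_mass _ _ (meeting _ _) _; have u0 : 0 <= u by apply/kept_mass_ge0/meeting_ge0.
have [gd|bad] := boolP (typical i w).
  have X0 := typical_ge gd; rewrite (hit_typical _ gd) -/u.
  set X := kept_mass _ _ _ _ in X0 *.
  have -> : u / X - u = u / X * (1 - X) by field; lra.
  rewrite normrM distrC ler_wpM2r//.
  rewrite ger0_norm ?divr_ge0//; last lra.
  by rewrite ler_pdivrMr; [nra|lra].
rewrite (hit_atypical _ bad) sub0r normrN ger0_norm//.
by move: bad; rewrite /typical -ltNge; nra.
Qed.

Lemma hit_le S i w : hit S i w <= 2 * kept_mass W p (meeting S (pi i)) w.
Proof.
have u0 : 0 <= kept_mass W p (meeting S (pi i)) w by apply/kept_mass_ge0/meeting_ge0.
have [gd|bad] := boolP (typical i w); last by rewrite (hit_atypical _ bad) mulr_ge0.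
have X0 := typical_ge gd; rewrite (hit_typical _ gd).
by rewrite ler_pdivrMr; [nra|lra].
Qed.

Lemma kept_mass_meeting_le S i w : i \in I ->
  kept_mass W p (meeting S (pi i)) w <= G * \sum_(v in S) degree (pi i) v.
Proof.
move=> iI; apply: (@le_trans _ _ (G * \sum_e meeting S (pi i) e)).
  rewrite mulr_sumr; apply: ler_sum => e _.
  have [->|te] := eqVneq (meeting S (pi i) e) 0; first by rewrite !mul0r mulr0.
  have t0 := meeting_ge0 S (pi_ge0 i) e.
  rewrite -mulrA mulrC ler_wpM2r// -[leRHS]mulr1; apply: ler_pM.
  - by rewrite invr_ge0 ltW.
  - exact: survives_ge0.
  - exact: (weight_inv_leG p01 Gwt (fintype.subxx _) (pi_supp iI (meeting_supp te))).
  - exact: survives_le1.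
by rewrite ler_wpM2l ?sum_meeting_le//; move: r1G; lra.
Qed.

Lemma sum_kept_mass_meeting S w :
  \sum_(i in I) kept_mass W p (meeting S (pi i)) w = kept_mass W p (meeting S intensity) w.
Proof.
rewrite exchange_big /=; apply: eq_bigr => e _.
rewrite -!mulr_suml /meeting; case: ifP => // _.
by rewrite big1.
Qed.

Lemma intensity_ge0 e : 0 <= intensity e.
Proof. exact: sumr_ge0. Qed.

Lemma intensity_supp e : intensity e != 0 -> #|e|%:R <= r.
Proof.
move=> te; have [/existsP[i /andP[iI]]|/existsPn h] :=
  boolP [exists i, (i \in I) && (pi i e != 0)]; first exact: pi_supp.
move: te; rewrite /intensity big1 ?eqxx// => i iI.
by have := h i; rewrite iI /= negbK => /eqP.
Qed.

Lemma degree_intensity v : degree intensity v = \sum_(i in I) degree (pi i) v.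
Proof. by rewrite /degree exchange_big. Qed.

Lemma codegree_intensity s t :
  codegree intensity s t = \sum_(i in I) codegree (pi i) s t.
Proof. by rewrite /codegree exchange_big. Qed.

Lemma degree_ge0 (tau : {set V} -> R) v : (forall e, 0 <= tau e) -> 0 <= degree tau v.
Proof. by move=> t0; apply: sumr_ge0. Qed.

Lemma rate_ge0 S : 0 <= rate S.
Proof.
apply: sumr_ge0 => v _; rewrite divr_ge0//; last exact: ltW.
by apply: sumr_ge0 => i _; exact: degree_ge0.
Qed.

Lemma rate_le S : rate S <= #|S|%:R * D.
Proof.
rewrite mulr_natl -sumr_const; apply: ler_sum => v _.
by rewrite ler_pdivrMr.
Qed.

Lemma sum_degree_intensity_le S : \sum_(v in S) degree intensity v <= #|S|%:R * D.
Proof.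
rewrite mulr_natl -sumr_const; apply: ler_sum => v _.
rewrite degree_intensity; apply: le_trans (deg v) _.
have /andP[_ p1] := p01 v; have /andP[D0 _] := D0G.
by rewrite -[leRHS]mulr1 ler_wpM2l.
Qed.

(** The second moment bound with [S] empty, where the overlap parameter is given
by sparsity. *)
Lemma norm_deviation_le i c : i \in I -> 0 < c ->
  expect q (fun w => `|kept_mass W p (pi i) w - 1|) <= (c + 6 * G ^+ 4 * b / c) / 2.
Proof.
move=> iI c0.
have sv1 : forall w, survives W finset.set0 w = 1 :> R.
  by move=> w; rewrite /survives finset.sub0set.
have -> : expect q (fun w => `|kept_mass W p (pi i) w - 1|) =
  expect q (fun w => survives W finset.set0 w * `|kept_mass W p (pi i) w - 1|).
  by apply: eq_bigr => w _; rewrite sv1 mul1r.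
apply: le_trans (expect_abs_le W q_ge0 q_sum1 _ _ c0) _.
have /andP[b0 b1] := b01; have /andP[d0 db] := delta_b; have /andP[r1 rG] := r1G.
have n1 : 1 <= Num.sqrt #|I|%:R :> R.
  by rewrite -[leLHS]sqrtr1 ler_sqrt// ler1n card_gt0; apply/set0Pn; exists i.
have deg1 v : v \notin (finset.set0 : {set V}) ->
    \sum_(e : {set V} | v \in e) pi i e <= delta.
  move=> _; apply: le_trans (sparse v iI) _.
  by rewrite ler_pdivrMr ?ler_peMr//; lra.
have G1 : 1 <= G by lra.
have r0 : 0 <= r by lra.
have m1 : mean_mass p (pi i) finset.set0 = 1.
  rewrite -(pi_sum1 i); apply: eq_bigr => e _.
  by rewrite finset.setI0 weight0 divr1.
have := deviation_le p01 b0 G1 r0 approx Gwt (pi_ge0 i)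
  (fun e => @pi_supp i e iI) _ deg1 d0 ler01.
rewrite cards0 => /(_ B0).
rewrite m1 pi_sum1 weight0 mul1r mulr1 subrr expr0n /= add0r.
have -> : (1 + 1) ^+ 2 = 4 :> R by ring.
set E := expect _ _ => h.
rewrite ler_pM2r ?invr_gt0// lerD2l ler_pM2r ?invr_gt0//; apply: le_trans h _.
have G41 : 1 <= G ^+ 4 by rewrite exprn_ege1.
have : G ^+ 3 * (delta * r) <= G ^+ 4 * b.
  rewrite [G ^+ 4]exprSr -mulrA ler_wpM2l ?exprn_ge0//; first lra.
  by rewrite mulrC ler_pM.
set x := G ^+ 3 * _; set y := G ^+ 4 in G41 *; move=> xy.
have x0 : 0 <= x by rewrite mulr_ge0 ?exprn_ge0 ?mulr_ge0//; lra.
by nra.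
Qed.

(** The [x_i] add up to the mass of a single superposed weight, [intensity], so
the total load has the same shape as each [X_i]; here the overlap parameter
comes from the codegrees. *)
Lemma load_deviation_le S c : #|S|%:R <= B -> #|S|%:R <= G -> 0 < c ->
  expect q (fun w => survives W S w * `|kept_mass W p (meeting S intensity) w - rate S|) <=
  (c + 7 * G ^+ 8 * b / c) / 2.
Proof.
move=> SB SG c0; apply: le_trans (expect_abs_le W q_ge0 q_sum1 _ _ c0) _.
have /andP[b0 b1] := b01; have /andP[d0 db] := delta_b; have /andP[r1 rG] := r1G.
have /andP[D0 DG] := D0G.
have G1 : 1 <= G by lra.
have G0 : 0 <= G by lra.
have r0 : 0 <= r by lra.
have n0 : 0 <= #|S|%:R :> R by [].
set n : R := #|S|%:R in n0 SB SG.
have theta0 : 0 <= n * delta by rewrite mulr_ge0.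
have cg s t : s != t -> codegree intensity s t <= delta.
  by rewrite codegree_intensity; exact: codeg.
have th v : v \notin S ->
    \sum_(e : {set V} | v \in e) meeting S intensity e <= n * delta.
  move=> vS; apply: le_trans (degree_meeting_le _ _ intensity_ge0) _.
  rewrite mulr_natl -sumr_const; apply: ler_sum => s sS; apply: cg.
  by apply: contraNneq vS => <-.
have t0 := meeting_ge0 S intensity_ge0.
have ts e : meeting S intensity e != 0 -> #|e|%:R <= r.
  by move=> /meeting_supp /intensity_supp.
have := deviation_le p01 b0 G1 r0 approx Gwt t0 ts SB th theta0 (rate_ge0 S).
have tot : \sum_e meeting S intensity e <= G ^+ 2.
  apply: le_trans (sum_meeting_le S intensity_ge0) _.
  apply: le_trans (sum_degree_intensity_le S) _.
  by rewrite expr2 ler_pM.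
have tot0 : 0 <= \sum_e meeting S intensity e by exact: sumr_ge0.
have M0 : 0 <= mean_mass p (meeting S intensity) S by exact: mean_mass_ge0.
have MG : mean_mass p (meeting S intensity) S <= G ^+ 3.
  apply: le_trans (mean_mass_le p01 Gwt S t0 ts) _.
  by rewrite exprS ler_wpM2l.
have yG : rate S <= G ^+ 3.
  apply: le_trans (rate_le S) _; rewrite exprS.
  by apply: ler_pM => //; apply: le_trans DG _; rewrite ler_peMr.
have y0 := rate_ge0 S.
have My : `|mean_mass p (meeting S intensity) S - rate S| <= G ^+ 4 * b.
  have := mean_mass_meeting S p01 r1 rG d0 Gwt intensity_ge0 intensity_supp cg.
  under eq_bigr => v _ do rewrite degree_intensity.
  move/le_trans; apply.
  have -> : G ^+ 4 = G ^+ 2 * G ^+ 2 by ring.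
  rewrite -mulrA ler_wpM2l ?sqr_ge0//.
  by apply: ler_pM => //; rewrite ?sqr_ge0// ler_pXn2r ?nnegrE.
set M := mean_mass _ _ _ in M0 MG My *; set y := rate S in yG y0 My *.
set t := \sum_e _ in tot tot0 *; set E := expect _ _; set s := weight p S => h.
have h1 : (M - y) ^+ 2 <= G ^+ 8 * b.
  rewrite -(real_normK (num_real _)).
  have -> : G ^+ 8 = G ^+ 4 * G ^+ 4 by ring.
  apply: (@le_trans _ _ (G ^+ 4 * b * (G ^+ 4 * b))); first by rewrite expr2 ler_pM.
  have : G ^+ 4 * G ^+ 4 * b * b <= G ^+ 4 * G ^+ 4 * b * 1.
    by rewrite ler_wpM2l// !mulr_ge0// exprn_ge0.
  lra.
have h2 : (M + y) ^+ 2 <= 4 * G ^+ 8.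
  apply: (@le_trans _ _ ((2 * G ^+ 3) ^+ 2)).
    rewrite ler_pXn2r ?nnegrE ?addr_ge0 ?mulr_ge0 ?exprn_ge0//; lra.
  rewrite exprMn -exprM; have -> : (2 ^+ 2 = 4 :> R) by ring.
  by rewrite ler_wpM2l// ler_weXn2l.
have h3 : G ^+ 3 * (n * delta * (r * t)) <= G ^+ 8 * b.
  apply: (@le_trans _ _ (G ^+ 3 * (G * b * (G * G ^+ 2)))).
    by rewrite ler_wpM2l ?exprn_ge0// ler_pM ?mulr_ge0// ler_pM.
  have -> : G ^+ 3 * (G * b * (G * G ^+ 2)) = G ^+ 7 * b by ring.
  by rewrite ler_wpM2r// ler_weXn2l.
have h30 : 0 <= G ^+ 3 * (n * delta * (r * t)) by rewrite !mulr_ge0// exprn_ge0.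
have s0 : 0 < s by exact: weight_p_gt0.
have s1 : s <= 1 by exact: weight_le1.
have h4 : b * (M + y) ^+ 2 <= b * (4 * G ^+ 8) by rewrite ler_wpM2l.
rewrite ler_pM2r ?invr_gt0// lerD2l ler_pM2r ?invr_gt0//; apply: le_trans h _.
move: h1 h3 h30 h4; set x1 := (M - y) ^+ 2; set x2 := b * (M + y) ^+ 2.
set x3 := G ^+ 3 * _; set g := G ^+ 8 => h1 h3 h30 h4.
have x10 : 0 <= x1 by exact: sqr_ge0.
have x20 : 0 <= x2 by rewrite mulr_ge0// sqr_ge0.
have h5 : (1 + b) * x3 <= 2 * x3 by rewrite ler_wpM2r//; lra.
have h50 : 0 <= (1 + b) * x3 by rewrite mulr_ge0//; lra.
apply: (@le_trans _ _ (1 * (x1 + x2 + (1 + b) * x3))).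
  by rewrite ler_wpM2r// !addr_ge0.
lra.
Qed.

(** This is where the factor [(# I) ^ (- 1 / 2)] in the sparsity hypothesis is
used: the squares of [#|I|] such terms add up to a quantity free of [#|I|]. *)
Lemma sum_square_degree_le S : 0 <= delta ->
  \sum_(i in I) (\sum_(v in S) degree (pi i) v) ^+ 2 <=
  (#|S|%:R * delta) ^+ 2.
Proof.
move=> d0.
have [->|/set0Pn[i0 i0I]] := eqVneq I finset.set0.
  by rewrite big_set0 sqr_ge0.
have n0 : 0 < #|I|%:R :> R by rewrite ltr0n card_gt0; apply/set0Pn; exists i0.
have sn0 : 0 < Num.sqrt #|I|%:R :> R by rewrite sqrtr_gt0.
have -> : (#|S|%:R * delta) ^+ 2 =
    \sum_(i in I) (#|S|%:R * (delta / Num.sqrt #|I|%:R)) ^+ 2.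
  rewrite sumr_const -[RHS]mulr_natl mulrA [in RHS]expr_div_n sqr_sqrtr ?ltW//.
  by field; lra.
apply: ler_sum => i iI; rewrite ler_pXn2r ?nnegrE//.
- rewrite mulr_natl -sumr_const; apply: ler_sum => v _; exact: sparse.
- by apply: sumr_ge0 => v _; exact: degree_ge0.
- by rewrite mulr_ge0// divr_ge0// ltW.
Qed.

(** The three sums are the second order terms of the product, the effect of the
normalizations [X_i], and the deviation of the load.  The indicator of
[S \subset W] is kept only in the last one, since the load is close to
[rate S] only on that event. *)
Lemma prod_miss_sub_exp_le S w :
  survives W S w * `|\prod_(i in I) (1 - hit S i w) - expR (- rate S)| <=
  \sum_(i in I) (2 * (G * \sum_(v in S) degree (pi i) v)) ^+ 2 +
  \sum_(i in I) 2 * (G * \sum_(v in S) degree (pi i) v) *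
    `|kept_mass W p (pi i) w - 1| +
  survives W S w * `|kept_mass W p (meeting S intensity) w - rate S|.
Proof.
have := prod_sub_exp_le (fun i _ => hit01 S i w) (rate_ge0 S) (A := I).
set x := `|_ - expR _|; set y := `|_ - rate S| => xy.
have sq : \sum_(i in I) hit S i w ^+ 2 <=
    \sum_(i in I) (2 * (G * \sum_(v in S) degree (pi i) v)) ^+ 2.
  apply: ler_sum => i iI; have /andP[h0 _] := hit01 S i w.
  have h : hit S i w <= 2 * (G * \sum_(v in S) degree (pi i) v).
    by apply: le_trans (hit_le S i w) _; rewrite ler_wpM2l// kept_mass_meeting_le.
  by rewrite ler_pXn2r ?nnegrE// (le_trans h0).
have di : y <= \sum_(i in I) 2 * (G * \sum_(v in S) degree (pi i) v) *
    `|kept_mass W p (pi i) w - 1| + `|kept_mass W p (meeting S intensity) w - rate S|.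
  rewrite /y -sum_kept_mass_meeting.
  have -> : \sum_(i in I) hit S i w - rate S =
    \sum_(i in I) (hit S i w - kept_mass W p (meeting S (pi i)) w) +
    (\sum_(i in I) kept_mass W p (meeting S (pi i)) w - rate S).
    by rewrite sumrB; ring.
  apply: le_trans (ler_normD _ _) _; rewrite lerD2r.
  apply: le_trans (ler_norm_sum _ _ _) _; apply: ler_sum => i iI.
  apply: le_trans (hit_sub_le S i w) _.
  by rewrite ler_wpM2r// ler_wpM2l// kept_mass_meeting_le.
move: sq di; set s := survives W S w; set a4 := `|kept_mass _ _ _ _ - rate S|.
set a2 := \sum_(i in I) (2 * _) ^+ 2; set a3 := \sum_(i in I) 2 * _ * _.
move=> sq di.
have s0 : 0 <= s by exact: survives_ge0.
have s1 : s <= 1 by exact: survives_le1.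
have a30 : 0 <= a2 + a3.
  apply: addr_ge0; apply: sumr_ge0 => i iI; first exact: sqr_ge0.
  rewrite !mulr_ge0//; first by move: r1G; lra.
  by apply: sumr_ge0 => v _; exact: degree_ge0.
apply: (@le_trans _ _ (s * (a2 + a3 + a4))).
  by rewrite ler_wpM2l//; lra.
by rewrite [leLHS]mulrDr lerD2r -[leRHS]mul1r ler_wpM2r.
Qed.

(** The errors are bounded absolutely, by multiples of [G ^ 8 * eps ^ 2], and
compared to the target only at the end, through the lower bound [G^-1] on
it. *)
Lemma step_estimate (eps : R) S : 0 < eps -> b <= eps ^+ 10 ->
  16 * G ^+ 9 * eps <= 1 -> #|S|%:R <= B -> #|S|%:R <= G ->
  1 <= G * (weight p S * expR (- rate S)) ->
  `|expect q (fun w => survives W S w * \prod_(i in I) (1 - hit S i w)) -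
    weight p S * expR (- rate S)| <= eps * (weight p S * expR (- rate S)).
Proof.
move=> eps0 beps Geps SB SG Gtgt.
have /andP[b0 b1] := b01; have /andP[d0 db] := delta_b; have /andP[r1 rG] := r1G.
have /andP[D0 DG] := D0G.
have G1 : 1 <= G by lra.
have G0 : 0 <= G by lra.
have eps1 : eps <= 1.
  apply: le_trans Geps; rewrite ler_peMl// ?ltW//.
  have : 1 <= G ^+ 9 by rewrite exprn_ege1.
  by lra.
have eps0' : 0 <= eps := ltW eps0.
(* The scale for [expect_abs_le]: the deviations have second moment of order
   [eps ^+ 10], so [b / c] is still at most [c], while [c] itself gains a full
   factor [eps] over the target. *)
set c := eps ^+ 2.
have c0 : 0 < c by rewrite exprn_gt0.
have bcc : b / c <= c.
  rewrite ler_pdivrMr//; apply: le_trans beps _.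
  by rewrite /c -exprD; apply: ler_wiXn2l => //; exact: ltW.
have bc : b <= c.
  apply: le_trans beps _; by apply: ler_wiXn2l => //; exact: ltW.
pose beta i := \sum_(v in S) degree (pi i) v.
have beta0 i : 0 <= beta i by apply: sumr_ge0 => v _; exact: degree_ge0.
have sbeta : \sum_(i in I) beta i <= G ^+ 2.
  rewrite /beta exchange_big /=.
  under eq_bigr => v _ do rewrite -degree_intensity.
  apply: le_trans (sum_degree_intensity_le S) _.
  by rewrite expr2 ler_pM.
have g48 : G ^+ 4 <= G ^+ 8 by rewrite ler_weXn2l.
have g78 : G ^+ 7 <= G ^+ 8 by rewrite ler_weXn2l.
have g18 : 1 <= G ^+ 8 by rewrite exprn_ege1.
have g14 : 1 <= G ^+ 4 by rewrite exprn_ege1.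
set e := expR (- rate S).
have e0 : 0 < e := expR_gt0 _.
have e1 : e <= 1.
  by rewrite /e -expR0 ler_expR; have := rate_ge0 S; lra.
have t1 : \sum_(i in I) (2 * (G * beta i)) ^+ 2 <= 4 * G ^+ 8 * c.
  under eq_bigr => i _ do rewrite exprMn exprMn mulrA.
  rewrite -mulr_sumr.
  apply: (@le_trans _ _ (2 ^+ 2 * G ^+ 2 * (G * c) ^+ 2)).
    rewrite ler_wpM2l ?mulr_ge0 ?exprn_ge0//.
    apply: le_trans (sum_square_degree_le S d0) _.
    rewrite ler_pXn2r ?nnegrE ?mulr_ge0// ?(ltW c0)//.
    by apply: ler_pM => //; lra.
  have -> : 2 ^+ 2 * G ^+ 2 * (G * c) ^+ 2 = 4 * (G ^+ 4 * (c * c)) by ring.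
  rewrite -mulrA ler_wpM2l//; apply: ler_pM => //.
  - by rewrite exprn_ge0.
  - by rewrite mulr_ge0// ltW.
  rewrite ler_piMl//; first exact: ltW.
  by rewrite exprn_ile1// ltW.
have t2 : \sum_(i in I) 2 * (G * beta i) *
    expect q (fun w => `|kept_mass W p (pi i) w - 1|) <= 7 * G ^+ 8 * c.
  apply: (@le_trans _ _ (\sum_(i in I) beta i * (7 * G ^+ 5 * c))).
    apply: ler_sum => i iI.
    have : expect q (fun w => `|kept_mass W p (pi i) w - 1|) <= 7 / 2 * G ^+ 4 * c.
      apply: le_trans (norm_deviation_le iI c0) _.
      have : G ^+ 4 * (b / c) <= G ^+ 4 * c by rewrite ler_wpM2l// exprn_ge0.
      have : 1 * c <= G ^+ 4 * c by rewrite ler_wpM2r// ltW.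
      rewrite (_ : 6 * _ * b / c = 6 * (G ^+ 4 * (b / c))); last by rewrite !mulrA.
      rewrite -[7 / 2 * _ * c]mulrA.
      by set z := G ^+ 4 * (b / c); set z' := G ^+ 4 * c; lra.
    set E := expect _ _ => hE.
    have -> : 2 * (G * beta i) * E = beta i * (2 * G * E) by ring.
    rewrite ler_wpM2l//.
    apply: (@le_trans _ _ (2 * G * (7 / 2 * G ^+ 4 * c))).
      by rewrite ler_wpM2l// mulr_ge0.
    by rewrite le_eqVlt; apply/orP; left; apply/eqP; field.
  rewrite -mulr_suml.
  apply: (@le_trans _ _ (G ^+ 2 * (7 * G ^+ 5 * c))).
    by rewrite ler_wpM2r// !mulr_ge0 ?exprn_ge0// ltW.
  have -> : G ^+ 2 * (7 * G ^+ 5 * c) = 7 * G ^+ 7 * c by ring.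
  by rewrite ler_wpM2r ?(ltW c0)// ler_wpM2l.
have t3 : expect q (fun w => survives W S w *
    `|kept_mass W p (meeting S intensity) w - rate S|) <= 4 * G ^+ 8 * c.
  apply: le_trans (load_deviation_le SB SG c0) _.
  have : G ^+ 8 * (b / c) <= G ^+ 8 * c by rewrite ler_wpM2l// exprn_ge0.
  have : 1 * c <= G ^+ 8 * c by rewrite ler_wpM2r// ltW.
  rewrite (_ : 7 * _ * b / c = 7 * (G ^+ 8 * (b / c))); last by rewrite !mulrA.
  rewrite -[4 * _ * c]mulrA.
  by set z := G ^+ 8 * (b / c); set z' := G ^+ 8 * c; lra.
have t0 : `|expect q (survives W S) - weight p S| * e <= 1 * G ^+ 8 * c.
  have h : `|expect q (survives W S) - weight p S| <= b * weight p S.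
    by apply: approx; lra.
  have w1 : weight p S <= 1 by exact: weight_le1.
  have w0 : 0 < weight p S by exact: weight_p_gt0.
  apply: (@le_trans _ _ (b * 1)).
    rewrite -[leRHS]mulr1; apply: ler_pM => //; first exact: ltW.
    by apply: le_trans h _; rewrite ler_wpM2l.
  by rewrite mulr1 mul1r; apply: le_trans bc _; rewrite ler_peMl// ltW.
have -> : expect q (fun w => survives W S w * \prod_(i in I) (1 - hit S i w)) -
    weight p S * e =
    expect q (fun w => survives W S w * (\prod_(i in I) (1 - hit S i w) - e)) +
    e * (expect q (survives W S) - weight p S).
  rewrite mulrBr addrA [weight p S * e]mulrC; congr (_ - _).
  by rewrite -expect_lin; apply: eq_bigr => w _; ring.
apply: le_trans (ler_normD _ _) _; rewrite normrM (ger0_norm (ltW e0)) [e * _]mulrC.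
have t4 : `|expect q (fun w => survives W S w *
    (\prod_(i in I) (1 - hit S i w) - e))| <= 15 * G ^+ 8 * c.
  apply: le_trans (ler_norm_sum _ _ _) _.
  under eq_bigr => w _.
    rewrite normrM (ger0_norm (q_ge0 w)) normrM (ger0_norm (survives_ge0 _ _ _ _)).
    over.
  rewrite -/(expect q (fun w => survives W S w * `|\prod_(i in I) (1 - hit S i w) - e|)).
  apply: le_trans (expect_le q_ge0 (prod_miss_sub_exp_le S)) _.
  rewrite (_ : expect _ _ = \sum_(i in I) (2 * (G * beta i)) ^+ 2 +
    \sum_(i in I) 2 * (G * beta i) * expect q (fun w => `|kept_mass W p (pi i) w - 1|) +
    expect q (fun w => survives W S w *
      `|kept_mass W p (meeting S intensity) w - rate S|)); last first.
    rewrite !expect_add (expect_cst q_sum1) expect_sum; congr (_ + _ + _).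
    by apply: eq_bigr => i _; rewrite expect_scale.
  by lra.
have Gt : 0 < G by lra.
have fin : 16 * G ^+ 8 * c <= eps * (weight p S * e).
  rewrite -(ler_pM2l Gt).
  have -> : G * (16 * G ^+ 8 * c) = 16 * G ^+ 9 * eps * eps by rewrite /c; ring.
  apply: (@le_trans _ _ (1 * eps)); first by rewrite ler_wpM2r// ltW.
  by rewrite mulrCA mulrC ler_wpM2l// ltW.
by lra.
Qed.

End Step.

(** * Adding conditionally independent choices *)

Section Extension.
Variables (R : realType) (V T Om : finType).
Variables (q : Om -> R) (k : Om -> T -> {set V} -> R).
Hypotheses (q_ge0 : forall w, 0 <= q w) (q_sum1 : \sum_w q w = 1).
Hypotheses (k_ge0 : forall w i e, 0 <= k w i e).
Hypotheses (k_sum1 : forall w i, \sum_e k w i e = 1).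

Definition ext_law (x : Om * {ffun T -> {set V}}) : R :=
  q x.1 * \prod_i k x.1 i (x.2 i).

Lemma ext_law_ge0 x : 0 <= ext_law x.
Proof. by rewrite mulr_ge0// prodr_ge0. Qed.

(** Exchanging sum and product over the choices is the conditional independence
of the new sets. *)
Lemma expect_ext (g : Om -> R) (h : T -> {set V} -> R) :
  expect ext_law (fun x => g x.1 * \prod_i h i (x.2 i)) =
  expect q (fun w => g w * \prod_i \sum_e k w i e * h i e).
Proof.
rewrite /expect -(pair_bigA _ (fun w f =>
  ext_law (w, f) * (g w * \prod_i h i (f i)))) /=.
apply: eq_bigr => w _; rewrite bigA_distr_bigA /= !mulr_sumr.
apply: eq_bigr => f _; rewrite /ext_law /= big_split /=; ring.
Qed.

Lemma expect_ext_fst (g : Om -> R) : expect ext_law (fun x => g x.1) = expect q g.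
Proof.
rewrite [LHS](_ : _ = expect ext_law (fun x => g x.1 * \prod_(i : T) 1)); last first.
  by apply: eq_bigr => x _; rewrite big1 ?mulr1.
rewrite (expect_ext g (fun _ _ => 1)); apply: eq_bigr => w _.
rewrite big1 ?mulr1// => i _.
by under eq_bigr => e _ do rewrite mulr1.
Qed.

Lemma ext_law_sum1 : \sum_x ext_law x = 1.
Proof.
have := expect_ext_fst (fun=> 1).
by rewrite (expect_cst q_sum1) /expect; under eq_bigr do rewrite mulr1.
Qed.

Lemma ext_law_gt0 w f : 0 < ext_law (w, f) -> 0 < q w /\ forall i, 0 < k w i (f i).
Proof.
rewrite /ext_law /= => h; split.
  rewrite lt_neqAle q_ge0 andbT eq_sym; apply: contraTneq h => ->.
  by rewrite mul0r ltxx.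
move=> i; rewrite lt_neqAle k_ge0 andbT eq_sym; apply: contraTneq h => k0.
by rewrite (bigD1 i)//= k0 mul0r mulr0 ltxx.
Qed.

Lemma expect_ext_survives (W : Om -> {set V}) (I : {set T}) (S : {set V}) :
  expect ext_law (survives
    (fun x : Om * {ffun T -> {set V}} => W x.1 :\: (\bigcup_(i in I) x.2 i)%SET)
    S) =
  expect q (fun w => survives W S w *
    \prod_(i in I) \sum_(e : {set V} | e :&: S == finset.set0) k w i e).
Proof.
pose h i (e : {set V}) : R :=
  if i \in I then (e :&: S == finset.set0)%:R else 1.
transitivity (expect ext_law (fun x => survives W S x.1 * \prod_i h i (x.2 i))).
  apply: eq_bigr => -[w f] _; congr (_ * _); rewrite /survives /=.
  rewrite finset.subsetD -mulnb natrM; congr (_ * _).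
  have [dj|/pred0Pn[v /= /andP[vS /bigcupP[i iI vi]]]] := boolP [disjoint S & _].
    rewrite big1// => i _; rewrite /h; case: ifP => // iI.
    suff -> : f i :&: S = finset.set0 by rewrite eqxx.
    apply/eqP; rewrite finset.setI_eq0 disjoint_sym.
    by apply: disjointWr dj; exact: (finset.bigcup_sup i).
  rewrite (bigD1 i)//= /h iI.
  have -> : (f i :&: S == finset.set0) = false; last by rewrite mul0r.
  by apply/negbTE/set0Pn; exists v; rewrite finset.in_setI vi.
rewrite expect_ext; apply: eq_bigr => w _; congr (_ * (_ * _)).
rewrite [RHS]big_mkcond; apply: eq_bigr => i _; rewrite /h.
case: ifP => _; last by under eq_bigr do rewrite mulr1.
rewrite [RHS]big_mkcond; apply: eq_bigr => e _.
by case: ifP; rewrite ?mulr1 ?mulr0.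
Qed.

End Extension.

(** * Iterating the stages *)

Section Iteration.
Variables (R : realType) (V T : finType) (I : nat -> {set T}).
Variables (pi : T -> {set V} -> R) (m : nat) (D r A G delta : R).

Definition stage_degree j v : R := \sum_(i in I j) degree (pi i) v.

Definition uncovered (Om : Type) (e' : T -> Om -> {set V}) J (w : Om) : {set V} :=
  (~: \bigcup_(1 <= j < J.+1) \bigcup_(i in I j) e' i w)%SET.

Definition accuracy J : R := delta `^ (1 / 10 ^+ J.+1).

Local Notation P := (survival stage_degree).

Hypotheses (r1 : 1 <= r) (D0 : 0 <= D) (DG : D <= G) (AG : A <= G).
Hypothesis delta01 : 0 < delta <= 1.
Hypothesis accG : forall J, (J <= m)%N -> 16 * G ^+ 9 * accuracy J <= 1.
Hypothesis I_disj : forall j k, (1 <= j <= m)%N -> (1 <= k <= m)%N -> j <> k ->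
  [disjoint I j & I k]%bool.
Hypotheses (pi_ge0 : forall i e, 0 <= pi i e).
Hypotheses (pi_sum1 : forall i, \sum_e pi i e = 1).
Hypothesis pi_supp : forall j i e, (1 <= j <= m)%N -> i \in I j ->
  pi i e != 0 -> #|e|%:R <= r.
Hypothesis sparse : forall j i v, (1 <= j <= m)%N -> i \in I j ->
  degree (pi i) v <= delta / Num.sqrt #|I j|%:R.
Hypothesis codeg : forall j s t, (1 <= j <= m)%N -> s != t ->
  \sum_(i in I j) codegree (pi i) s t <= delta.
Hypothesis deg : forall j v, (1 <= j <= m)%N -> stage_degree j v <= D * P j.-1 v.
Hypothesis P01 : forall j v, (j <= m)%N -> 0 < P j v <= 1.
Hypothesis PG : forall j (S : {set V}), (j <= m)%N -> #|S|%:R <= A ->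
  1 <= G * (weight (P j) S * expR (- (#|S|%:R * D))).

Lemma accuracy_gt0 J : 0 < accuracy J.
Proof. by have /andP[d0 _] := delta01; rewrite powR_gt0. Qed.

Lemma accuracy_le1 J : accuracy J <= 1.
Proof.
have /andP[d0 d1] := delta01.
have <- : 1 `^ (1 / 10 ^+ J.+1) = 1 :> R by rewrite powR1.
apply: ge0_ler_powR => //.
- by rewrite nnegrE ltW.
- by rewrite nnegrE.
Qed.

Lemma delta_le_accuracy J : delta <= accuracy J.
Proof.
have /andP[d0 d1] := delta01.
rewrite -[leLHS]powRr1; last exact: ltW.
apply: ger_powR => //; rewrite ler_pdivrMr ?exprn_gt0// mul1r.
by rewrite exprn_ege1// ler1n.
Qed.

Lemma accuracyS J : accuracy J.+1 ^+ 10 = accuracy J.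
Proof.
rewrite -powR_mulrn ?powR_ge0// -powRrM; congr (_ `^ _).
by rewrite [in LHS]exprS; field; rewrite expf_neq0.
Qed.

Lemma weight_survivalS j S :
  weight (P j.+1) S = weight (P j) S * expR (- rate (P j) (I j.+1) pi S).
Proof.
rewrite /weight /= big_split /=; congr (_ * _).
by rewrite /rate -sumrN expR_sum.
Qed.

Lemma uncoveredS (Om : Type) (e' : T -> Om -> {set V}) J w :
  uncovered e' J.+1 w = uncovered e' J w :\: (\bigcup_(i in I J.+1) e' i w)%SET.
Proof. by rewrite /uncovered big_nat_recr//= finset.setCU finset.setDE. Qed.

Lemma iterated_sieve J : (J <= m)%N ->
  exists (Om : finType) (q : Om -> R) (e' : T -> Om -> {set V}),
    [/\ forall w, 0 <= q w, \sum_w q w = 1,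
      forall j i w, (1 <= j <= J)%N -> i \in I j -> 0 < q w ->
        e' i w = finset.set0 \/ 0 < pi i (e' i w) &
      forall J' (S : {set V}), (J' <= J)%N -> #|S|%:R <= A - 2 * r * J'%:R ->
        `|expect q (survives (uncovered e' J') S) - weight (P J') S| <=
          accuracy J' * weight (P J') S].
Proof.
(* The new sets of stage [J.+1] live on the second component; the earlier ones
   are read off the first, so their joint law is unchanged. *)
elim: J => [_|J IH Jm].
  exists unit, (fun=> 1), (fun _ _ => finset.set0); split=> //.
  - by rewrite sumr_const card_unit.
  - by move=> j i w; case: j.
  move=> J' S; rewrite leqn0 => /eqP -> _.
  have -> : weight (P 0) S = 1 by rewrite /weight big1.
  rewrite /expect (eq_bigr (fun=> 1)) ?sumr_const ?card_unit => [|w _]; last first.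
    by rewrite /survives /uncovered big_geq// finset.setC0 finset.subsetT mulr1.
  by rewrite subrr normr0 mulr1 ltW ?accuracy_gt0.
have [Om [q [e' [q0 q1 supp est]]]] := IH (ltnW Jm).
have J1m : (1 <= J.+1 <= m)%N by rewrite Jm.
have P01J v : 0 < P J v <= 1 by apply: P01; exact: ltnW.
set W := uncovered e' J.
pose k := edge_law W (P J) pi.
have k0 w i e : 0 <= k w i e by exact: edge_law_ge0.
have k1 w i : \sum_e k w i e = 1 by exact: edge_law_sum1.
pose e'' i (x : Om * {ffun T -> {set V}}) :=
  if i \in I J.+1 then x.2 i else e' i x.1.
exists (Om * {ffun T -> {set V}})%type, (ext_law q k), e''.
have old j i x : (1 <= j <= J)%N -> i \in I j -> e'' i x = e' i x.1.
  move=> /andP[j1 jJ] iIj; rewrite /e''; case: ifP => // iI.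
  have jm : (1 <= j <= m)%N by rewrite j1 (leq_trans jJ)// ltnW.
  have jJ1 : j <> J.+1 by move=> jE; rewrite jE ltnn in jJ.
  by have /pred0P/(_ i)/= := I_disj jm J1m jJ1; rewrite iIj iI.
have oldU J' x : (J' <= J)%N -> uncovered e'' J' x = uncovered e' J' x.1.
  move=> J'J; congr (~: _)%SET; rewrite big_nat [RHS]big_nat.
  apply: eq_bigr => j /andP[j1 jJ']; apply: eq_bigr => i iI.
  by apply: old iI; rewrite j1 (leq_trans _ J'J).
split.
- exact: ext_law_ge0.
- exact: ext_law_sum1.
- move=> j i [w f] jJ iI /ext_law_gt0[]// qw kw.
  move: jJ; rewrite [(j <= J.+1)%N]leq_eqVlt => /andP[j1 /orP[/eqP jE|jJ]].
    by rewrite /e'' /= -jE iI; exact: edge_law_supp (kw i).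
  by rewrite (@old j)/= ?j1//; apply: supp iI qw; rewrite j1.
move=> J' S; rewrite leq_eqVlt => /orP[/eqP ->|J'J] SA; last first.
  have -> : expect (ext_law q k) (survives (uncovered e'' J') S) =
      expect q (survives (uncovered e' J') S).
    by rewrite -(expect_ext_fst q k1); apply: eq_bigr => x _; rewrite /survives oldU.
  exact: est.
set B := A - 2 * r * J.+1%:R in SA.
have -> : expect (ext_law q k) (survives (uncovered e'' J.+1) S) =
    expect q (fun w => survives W S w *
      \prod_(i in I J.+1) (1 - hit W (P J) pi S i w)).
  transitivity (expect (ext_law q k) (survives
    (fun x : Om * {ffun T -> {set V}} =>
       W x.1 :\: (\bigcup_(i in I J.+1) x.2 i)%SET) S)).
    apply: eq_bigr => x _; rewrite /survives uncoveredS oldU//.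
    congr (_ * (_ \subset _ :\: _)%:R).
    by apply: eq_bigr => i iI; rewrite /e'' iI.
  rewrite expect_ext_survives//; apply: eq_bigr => w _; congr (_ * (_ * _)).
  by apply: eq_bigr => i _; rewrite -miss_hit.
have /andP[d0 d1] := delta01.
(* The claim is empty unless [0 <= B], which then forces [2 * r <= A] and puts
   edges within the range of the bounds on [weight]. *)
have B0 : 0 <= B by apply: le_trans SA.
have rJ : r <= r * J.+1%:R by rewrite ler_peMr ?ler1n//; move: r1; lra.
have rA : r <= A by move: B0 r1; rewrite /B; lra.
have BA : B <= A by move: r1; rewrite /B; lra.
have G0 : 0 <= G by move: r1 AG; lra.
have expD (S' : {set V}) : expR (- (#|S'|%:R * D)) <= 1.
  by rewrite -expR0 ler_expR oppr_le0 mulr_ge0.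
have Gwt (K : {set V}) : #|K|%:R <= r -> 1 <= G * weight (P J) K.
  move=> Kr; apply: le_trans (PG (ltnW Jm) (le_trans Kr rA)) _.
  rewrite ler_wpM2l// -[leRHS]mulr1 ler_wpM2l// ltW// weight_gt0// => v.
  by have /andP[] := P01J v.
rewrite weight_survivalS.
apply: (@step_estimate R V T Om q W (P J) (I J.+1) pi r B G D delta (accuracy J)) => //.
- by rewrite ltW ?accuracy_gt0// accuracy_le1.
- by rewrite ltW// delta_le_accuracy.
- by rewrite r1 (le_trans rA AG).
- by rewrite D0 DG.
- move=> S' S'B; apply: est => //; apply: le_trans S'B _.
  by rewrite /B -[J.+1]addn1 natrD; lra.
- by move=> i e iI; apply: pi_supp iI.
- by move=> i v iI; apply: sparse iI.
- by move=> s t; apply: codeg.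
- by move=> v; exact: (deg v J1m).
- exact: accuracy_gt0.
- by rewrite accuracyS.
- exact: accG.
- by apply: le_trans SA _; apply: le_trans BA AG.
apply: le_trans (PG (ltnW Jm) (le_trans SA BA)) _.
rewrite ler_wpM2l// ler_wpM2l//.
  by rewrite ltW// weight_gt0// => v; have /andP[] := P01J v.
rewrite ler_expR lerN2; apply: rate_le => //.
by move=> v; exact: (deg v J1m).
Qed.

End Iteration.

(** * Passage between random sets and finite laws *)

Section FiniteLaws.
Variables (R : realType) (V : finType).

Lemma measurable_discrete_preimage (d : measure_display) (Om : measurableType d)
  (P : probability Om R) (X : {RV P >-> {set V}}) (B : set {set V}) :
  measurable [set w | B (X w)].
Proof.
rewrite -[X in measurable X]setTI.
exact: (measurable_funPT X measurableT B Logic.I).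
Qed.

Lemma Pr_law (d : measure_display) (Om : measurableType d)
    (P : probability Om R) (X : {RV P >-> {set V}}) (a : pred {set V}) :
  Pr P [set w | a (X w)] = \sum_(S | a S) Pr P [set w | X w = S].
Proof.
transitivity (Pr P [set w | X w \in [seq S <- index_enum {set V} | a S]]).
  congr (Pr P _); apply/seteqP; split=> w /=;
    by rewrite mem_filter mem_index_enum andbT.
rewrite -big_filter.
have : uniq [seq S <- index_enum {set V} | a S].
  by rewrite filter_uniq// index_enum_uniq.
elim: [seq _ <- _ | _] => [_|S s IH /= /andP[Ss us]].
  by rewrite big_nil /Pr (_ : [set _ | _] = set0) ?measure0// -subset0.
rewrite big_cons -IH// /Pr -fineD; last 2 first.
- exact/fin_num_measure/(measurable_discrete_preimage X (fun B => B = S)).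
- exact/fin_num_measure/(measurable_discrete_preimage X (fun B => B \in s)).
congr fine; rewrite -measureU.
- congr (P _); apply/seteqP; split=> w /=; rewrite in_cons.
    by case/orP=> [/eqP|]; [left|right].
  by case=> [->|->]; rewrite ?eqxx ?orbT.
- exact: (measurable_discrete_preimage X (fun B => B = S)).
- exact: (measurable_discrete_preimage X (fun B => B \in s)).
by apply/seteqP; split=> w //= [-> Sin]; rewrite Sin in Ss.
Qed.

Lemma Pr_ge0 (d : measure_display) (Om : measurableType d)
  (P : probability Om R) (E : set Om) : 0 <= Pr P E.
Proof. exact: fine_ge0. Qed.

Lemma ae_law (d : measure_display) (Om : measurableType d)
    (P : probability Om R) (X : {RV P >-> {set V}}) (a : pred {set V}) S :
  {ae P, forall w, a (X w)} -> Pr P [set w | X w = S] != 0 -> a S.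
Proof.
move=> aea; apply: contraNT => nS; rewrite /Pr.
have mS := measurable_discrete_preimage X (fun B => B = S).
suff -> : P [set w | X w = S] = 0%E by [].
apply/(measure_negligible mS); apply: negligibleS aea => w /= ->.
exact/negP.
Qed.

End FiniteLaws.

(** The space of joint values of the [e' i] is finite, so it carries the
discrete sigma-algebra. *)
HB.instance Definition _ (V T : finType) :=
  isPointed.Build {ffun T -> {set V}} [ffun=> finset.set0].

HB.instance Definition _ (V T : finType) :=
  @isMeasurable.Build default_measure_display {ffun T -> {set V}}
    discrete_measurable discrete_measurable0 discrete_measurableC
    discrete_measurableU.

Section Realization.
Variables (R : realType) (V T Om : finType).
Variables (q : Om -> R) (e : T -> Om -> {set V}).
Hypotheses (q_ge0 : forall w, 0 <= q w) (q_sum1 : \sum_w q w = 1).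

Definition joint w : {ffun T -> {set V}} := [ffun i => e i w].

Lemma atomic_measure (s : seq Om) :
  exists mu : {measure set {ffun T -> {set V}} -> \bar R},
  forall A, mu A = (\sum_(w <- s) q w * (joint w \in A)%:R)%:E.
Proof.
elim: s => [|w s [mu muE]]; first by exists mzero => A; rewrite big_nil.
exists (measure_add (mscale (NngNum (q_ge0 w)) (dirac (joint w))) mu) => A.
transitivity (mscale (NngNum (q_ge0 w)) (dirac (joint w)) A + mu A)%E.
  exact: measure_addE.
by rewrite muE big_cons EFinD.
Qed.

Lemma joint_probability :
  exists Q : probability {ffun T -> {set V}} R,
  forall A, Pr Q A = \sum_w q w * (joint w \in A)%:R /\
   Q A = (Pr Q A)%:E.
Proof.
have [mu muE] := atomic_measure (index_enum Om).
have mu1 : mu setT = 1%E.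
  by rewrite muE; congr EFin; rewrite -[RHS]q_sum1; apply: eq_bigr => w _; rewrite in_setT mulr1.
(* The total mass being [1], normalizing changes nothing, but it provides the
   probability structure. *)
pose Q : probability {ffun T -> {set V}} R := mnormalize mu (dirac point).
have QE A : Q A = mu A.
  by rewrite /Q /= /mnormalize/= mu1 onee_eq0/= invr1 mule1.
by exists Q => A; rewrite /Pr QE muE.
Qed.

Definition coordinate i (f : {ffun T -> {set V}}) : {set V} := f i.

Let coordinate_measurable i : measurable_fun setT (coordinate i).
Proof. by []. Qed.

HB.instance Definition _ i :=
  isMeasurableFun.Build _ _ _ _ (coordinate i) (@coordinate_measurable i).

End Realization.

Theorem theorem3 (R : realType) :
  exists C0 : R, 1 <= C0 /\
  forall (D r A kappa : R) (m : nat) (delta : R),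
  1 <= D -> 1 <= r -> 1 <= A ->
  0 < kappa -> kappa <= 1 / 2 ->
  0 < delta ->
  delta <= (kappa `^ A / (C0 * expR (A * D))) ^+ (10 ^ (m + 2))%N ->
  forall (T V : finType) (I : nat -> {set T}),
  (forall j : nat, (1 <= j <= m)%N -> I j != finset.set0) ->
  (forall j k : nat, (1 <= j <= m)%N -> (1 <= k <= m)%N -> j <> k ->
     [disjoint I j & I k]%bool) ->
  forall (d : T -> measure_display) (Omega : forall i : T, measurableType (d i))
    (P : forall i : T, probability (Omega i) R)
    (e : forall i : T, {RV (P i) >-> {set V}}),
  (* edges not too large *)
  (forall (j : nat) (i : T), (1 <= j <= m)%N -> i \in I j ->
     {ae P i, forall w, #|e i w|%:R <= r}) ->
  (* each sieve step is sparse *)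
  (forall (j : nat) (i : T) (v : V), (1 <= j <= m)%N -> i \in I j ->
     Pr (P i) [set w | v \in e i w] <= delta / Num.sqrt #|I j|%:R) ->
  (* very small codegrees *)
  (forall (j : nat) (v1 v2 : V), (1 <= j <= m)%N -> v1 <> v2 ->
     \sum_(i in I j) Pr (P i) [set w | (v1 \in e i w) && (v2 \in e i w)]
       <= delta) ->
  (* degree bound *)
  let deg := fun (j : nat) (v : V) => norm_degree e (I j) v in
  (forall (j : nat) (v : V), (1 <= j <= m)%N ->
     deg j v <= D * survival deg j.-1 v) ->
  (forall (j : nat) (v : V), (j <= m)%N -> kappa <= survival deg j v) ->
  exists (d' : measure_display) (Omega' : measurableType d')
    (Q : probability Omega' R) (e' : T -> {RV Q >-> {set V}}),
    (forall (j : nat) (i : T), (1 <= j <= m)%N -> i \in I j ->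
       {ae Q, forall w, e' i w = finset.set0 \/
          0 < Pr (P i) [set w0 | e i w0 = e' i w]}) /\
    (forall (J : nat) (S : {set V}), (J <= m)%N ->
       #|S|%:R <= A - 2 * r * J%:R ->
       `| Pr Q [set w | S \subset
              (~: \bigcup_(1 <= j < J.+1) \bigcup_(i in I j) e' i w)%SET]
          - \prod_(v in S) survival deg J v |
         <= delta `^ (1 / 10 ^+ J.+1) * \prod_(v in S) survival deg J v).

Proof.
exists 2; split=> [|D r A kappa m delta D1 r1 A1 k0 k12 d0 d_small T V I I_ne
  I_disj d Omega P e size_e sparse codeg deg deg_le kappa_le]; first by rewrite ler1n.
set G := expR (A * D) / kappa `^ A.
have kA0 : 0 < kappa `^ A by exact: powR_gt0.
have kA1 : kappa `^ A <= 1.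
  have <- : 1 `^ A = 1 :> R by rewrite powR1.
  apply: ge0_ler_powR; rewrite ?nnegrE//; lra.
have D0 : 0 <= D by lra.
have AD : A <= A * D by rewrite ler_peMr//; lra.
have DA : D <= A * D by rewrite ler_peMl//; lra.
have eG : expR (A * D) <= G by rewrite ler_peMr ?expR_ge0// invf_ge1.
have ADG : 1 + A * D <= G by apply: le_trans eG; exact: expR_ge1Dx.
have G1 : 1 <= G by lra.
have h_def : kappa `^ A / (2 * expR (A * D)) = (2 * G)^-1.
  by rewrite /G; field; rewrite !gt_eqF ?expR_gt0.
rewrite h_def in d_small; set h := (2 * G)^-1 in d_small.
have h0 : 0 < h by rewrite invr_gt0; lra.
have h1 : h <= 1 by rewrite invf_le1; lra.
have delta01 : 0 < delta <= 1.
  by rewrite d0 (le_trans d_small)// exprn_ile1// ltW.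
(* Comparing [10 ^ J.+1]-th powers turns the bound on [delta] into one on
   [accuracy delta J] without real exponents. *)
have acc_pow J : accuracy delta J ^+ (10 ^ J.+1) = delta.
  rewrite /accuracy -powR_mulrn ?powR_ge0// -powRrM natrX mul1r mulVf ?expf_neq0//.
  by rewrite powRr1// ltW.
have accG J : (J <= m)%N -> 16 * G ^+ 9 * accuracy delta J <= 1.
  move=> Jm; have acc_h : accuracy delta J <= h ^+ 10.
    rewrite leNgt; apply/negP => acc_lt.
    have : (h ^+ 10) ^+ (10 ^ J.+1) < delta.
      rewrite -[ltRHS](acc_pow J) ltr_pXn2r ?nnegrE ?expn_gt0//.
        by rewrite exprn_ge0// ltW.
      exact: powR_ge0.
    rewrite -exprM -expnS ltNge (le_trans d_small)//.
    by apply: ler_wiXn2l; rewrite ?(ltW h0)// leq_exp2l// addn2.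
  apply: (@le_trans _ _ (16 * G ^+ 9 * h ^+ 10)).
    by rewrite ler_wpM2l// mulr_ge0// exprn_ge0//; lra.
  have -> : 16 * G ^+ 9 * h ^+ 10 = (64 * G)^-1.
    by rewrite /h; field; rewrite gt_eqF//; lra.
  by rewrite invf_le1; lra.
pose pi i S := Pr (P i) [set w | e i w = S].
have degE : deg = stage_degree I pi.
  apply/funext => j; apply/funext => v; apply: eq_bigr => i _.
  exact: (Pr_law (e i) (fun S => v \in S)).
rewrite degE in deg_le kappa_le *.
have pi0 i S : 0 <= pi i S by exact: Pr_ge0.
have pi1 i : \sum_S pi i S = 1.
  rewrite -(Pr_law (e i) xpredT) /Pr.
  by rewrite (_ : [set _ | _] = setT) ?probability_setT//; apply/seteqP.
have surv_gt0 j v : (j <= m)%N -> 0 < survival (stage_degree I pi) j v.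
  by move=> jm; apply: lt_le_trans k0 (kappa_le j v jm).
have surv01 j v : (j <= m)%N -> 0 < survival (stage_degree I pi) j v <= 1.
  move=> jm; rewrite surv_gt0//=; elim: j jm => // j IH jm /=.
  apply: le_trans (IH (ltnW jm)); rewrite ler_piMr//; first exact/ltW/surv_gt0/ltnW.
  rewrite -expR0 ler_expR oppr_le0 divr_ge0//; last exact/ltW/surv_gt0/ltnW.
  by apply: sumr_ge0 => i _; exact: degree_ge0.
have surv_weight j (S : {set V}) : (j <= m)%N -> #|S|%:R <= A ->
    1 <= G * (weight (survival (stage_degree I pi) j) S * expR (- (#|S|%:R * D))).
  move=> jm SA.
  rewrite [leLHS](_ : 1 = G * (kappa `^ A * expR (- (A * D)))); last first.
    by rewrite expRN /G; field; rewrite !gt_eqF ?expR_gt0.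
  rewrite ler_wpM2l//; first lra.
  apply: ler_pM; [exact: ltW|exact: expR_ge0| |]; last first.
    by rewrite ler_expR lerN2 ler_wpM2r.
  apply: (@le_trans _ _ (kappa `^ #|S|%:R)).
    by apply: ger_powR => //; apply/andP; split; lra.
  rewrite powR_mulrn ?(ltW k0)// -prodr_const; apply: ler_prod => v _.
  by rewrite ltW//= kappa_le.
have DG : D <= G by lra.
have AG : A <= G by lra.
have [|||Om [q [e' [q0 q1 supp est]]]] :=
    @iterated_sieve R V T I pi m D r A G delta r1 D0 DG AG delta01 accG I_disj
      pi0 pi1 _ _ _ deg_le surv01 surv_weight m (leqnn m).
- move=> j i S jm iI; exact: (ae_law (a := fun S => #|S|%:R <= r) (size_e j i jm iI)).
- by move=> j i v jm iI; rewrite /degree -(Pr_law (e i) (fun S => v \in S)); exact: sparse.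
- move=> j s t jm /eqP st; apply: le_trans (codeg j s t jm st).
  apply: ler_sum => i _.
  by rewrite /codegree -(Pr_law (e i) (fun S => (s \in S) && (t \in S))).
have [Q QE] := joint_probability e' q0 q1.
exists _, _, Q, (fun i => coordinate i : {RV Q >-> {set V}}); split.
  move=> j i jm iI; pose N : set {ffun T -> {set V}} := 
    ~` [set f | coordinate i f = finset.set0 \/
        0 < Pr (P i) [set w0 | e i w0 = coordinate i f]].
  exists N; split => //; rewrite (QE N).2 (QE N).1 big1// => w _.
  have [->|qw] := eqVneq (q w) 0; first by rewrite mul0r.
  have {}qw : 0 < q w by rewrite lt_neqAle eq_sym qw q0.
  have := supp j i w jm iI qw.
  have [|_ _] := boolP (joint e' w \in N); last by rewrite mulr0.
  by rewrite inE /N /= /coordinate ffunE.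
move=> J S Jm SA; have := est J S Jm SA.
rewrite /weight; congr (`|_ - _| <= _).
rewrite (QE _).1; apply: eq_bigr => w _; congr (_ * _%:R).
rewrite /survives; congr nat_of_bool; rewrite /uncovered.
have cover_joint : \bigcup_(1 <= j < J.+1) \bigcup_(i in I j)
      coordinate i (joint e' w) =
    \bigcup_(1 <= j < J.+1) \bigcup_(i in I j) e' i w :> {set V}.
  by apply: eq_bigr => j _; apply: eq_bigr => i _; rewrite /coordinate ffunE.
by rewrite -cover_joint; apply/idP/idP; rewrite in_setE.
Qed.
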